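(* Let $(E,d)$ be a locally compact separable metric space and $m$ a Radon measure on $E$ with full topological support. Let $k$ be a non-negative Borel measurable function on $E\times E\setminus\{(x,x):x\in E\}$, and put $k_s(x,y)=\tfrac12(k(x,y)+k(y,x))$ and $k_a(x,y)=\tfrac12(k(x,y)-k(y,x))$. Assume $$x\mapsto\int_{y\neq x}\big(1\wedge d(x,y)^2\big)k_s(x,y)\,m(dy)\in L^1_{\mathrm{loc}}(E,m)$$ and $$\sup_{x\in E}\int_{\{y:\,k_s(x,y)\neq 0\}}\frac{k_a(x,y)^2}{k_s(x,y)}\,m(dy)<\infty .$$ Then: (i) For all $u,v\in C_c^{\mathrm{lip}}(E)$ the limit $\eta(u,v)=\lim_{n\to\infty}\eta_n(u,v)$ exists, and $$\eta(u,v)=\frac12\,\mathscr E(u,v)+\iint_{y\neq x}\big(u(x)-u(y)\big)v(y)\,k_a(x,y)\,m(dx)\,m(dy),$$ where the last integral is absolutely convergent. (ii) The form $\eta$ extends from $C_c^{\mathrm{lip}}(E)\times C_c^{\mathrm{lip}}(E)$ to $\mathscr F^0\times\mathscr F^0$ such that $(\eta,\mathscr F^0)$ is a regular lower bounded semi-Dirichlet form on $L^2(E,m)$.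
   Context: $C_c^{\mathrm{lip}}(E)$ denotes the Lipschitz continuous functions on $E$ with compact support; $\langle\cdot,\cdot\rangle_{L^2}$ and $\|\cdot\|_{L^2}$ are the inner product and norm of $L^2(E,m)$. For $n\in\mathbb N$ and $u\in C_c^{\mathrm{lip}}(E)$ set $L_nu(x)=\int_{\{y:\,d(x,y)>1/n\}}(u(y)-u(x))k(x,y)\,m(dy)$, and for $u,v\in C_c^{\mathrm{lip}}(E)$ set $\eta_n(u,v)=-\langle L_nu,v\rangle_{L^2}$. Define $\mathscr E(u,v)=\iint_{y\neq x}(u(x)-u(y))(v(x)-v(y))k_s(x,y)\,m(dx)\,m(dy)$, $\mathscr F^r=\{u\in L^2(E,m)\text{ Borel}:\mathscr E(u,u)<\infty\}$, $\mathscr E_1(u,u)=\mathscr E(u,u)+\|u\|_{L^2}^2$, and let $\mathscr F^0$ be the $\mathscr E_1$-closure of $C_c^{\mathrm{lip}}(E)$ in $\mathscr F^r$. A bilinear form $(\eta,\mathscr F)$ with $\mathscr F\subset L^2(E,m)$ is a lower bounded semi-Dirichlet form if for some $\alpha>0$ and $c>0$: (a) $\eta(u,u)\ge-\alpha\langle u,u\rangle_{L^2}$ for $u\in\mathscr F$; (b) $\eta(u,v)\le c\sqrt{\eta(u,u)+\alpha\langle u,u\rangle_{L^2}}\sqrt{\eta(v,v)+\alpha\langle v,v\rangle_{L^2}}$ for $u,v\in\mathscr F$; (c) $\mathscr F$ is complete with respect to the norm $(\eta(u,u)+\alpha\langle u,u\rangle_{L^2})^{1/2}$; (d) for all $u\in\mathscr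 F$, $u^+\wedge1\in\mathscr F$ and $\eta(u^+\wedge 1,u-u^+\wedge1)\ge0$. It is regular if $\mathscr F\cap C_c(E)$ is dense in $\mathscr F$ for the norm in (c) and dense in $C_c(E)$ for the uniform norm. *)

(* Defs.v *)
From HB Require Import structures.
From mathcomp Require Import all_boot all_order all_algebra.
From mathcomp Require Import all_classical all_reals all_analysis.
From mathcomp Require Import lebesgue_measure measurable_realfun.
Set Implicit Arguments. Unset Strict Implicit. Unset Printing Implicit Defensive.
Import Order.TTheory GRing.Theory Num.Theory.
Import numFieldNormedType.Exports.
Local Open Scope classical_set_scope.
Local Open Scope ring_scope.

Section MetricMeasure.
Variables (R : realType) (d : measure_display) (T : measurableType d).
Variable (dist : T -> T -> R).

Definition is_metric : Prop :=
  [/\ (forall x y, 0 <= dist x y),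
      (forall x y, dist x y = 0 <-> x = y),
      (forall x y, dist x y = dist y x) &
      (forall x y z, dist x z <= dist x y + dist y z)].

Definition mball (x : T) (r : R) : set T := [set y | dist x y < r].

Definition mopen (U : set T) : Prop :=
  forall x, U x -> exists r : R, 0 < r /\ mball x r `<=` U.

Definition mcompact (K : set T) : Prop :=
  forall G : set (set T), (forall U, G U -> mopen U) ->
    K `<=` \bigcup_(U in G) U ->
    exists (n : nat) (U : nat -> set T), (forall i, (i < n)%N -> G (U i)) /\
      (forall x, K x -> exists i, (i < n)%N /\ U i x).

Definition mlocally_compact : Prop :=
  forall x, exists r : R, 0 < r /\ exists K, mcompact K /\ mball x r `<=` K.

Definition mseparable : Prop :=
  exists D : set T, countable D /\
    forall x (e : R), 0 < e -> exists y, D y /\ dist x y < e.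

Definition borel_sigma : Prop := @measurable d T = <<s mopen >>.

Definition mcontinuous (f : T -> R) : Prop :=
  forall x (e : R), 0 < e -> exists δ : R, 0 < δ /\
    forall y, dist x y < δ -> `|f x - f y| < e.

Definition compact_support (f : T -> R) : Prop :=
  exists K, mcompact K /\ forall x, ~ K x -> f x = 0.

Definition Cc (f : T -> R) : Prop := mcontinuous f /\ compact_support f.

Definition Cc_lip (f : T -> R) : Prop :=
  (exists L : R, forall x y, `|f x - f y| <= L * dist x y) /\ compact_support f.

Definition radon (m : {measure set T -> \bar R}) : Prop :=
  [/\ (forall K, mcompact K -> (m K < +oo)%E),
      (forall A, measurable A ->
         m A = ereal_inf [set m U | U in [set U | mopen U /\ A `<=` U]]) &
      (forall U, mopen U ->
         m U = ereal_sup [set m K | K in [set K | mcompact K /\ K `<=` U]])].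

Definition full_support (m : {measure set T -> \bar R}) : Prop :=
  forall U, mopen U -> U !=set0 -> (0 < m U)%E.

Definition ks (k : T -> T -> R) x y := (k x y + k y x) / 2.
Definition ka (k : T -> T -> R) x y := (k x y - k y x) / 2.

Variable (m : {measure set T -> \bar R}).

Definition L2 (u : T -> R) : Prop :=
  measurable_fun setT u /\ (\int[m]_x ((u x) ^+ 2)%:E < +oo)%E.

Definition ip (u v : T -> R) : R := fine (\int[m]_x (u x * v x)%:E).

Definition ae_eq (u v : T -> R) : Prop := {ae m, forall x, u x = v x}.

Definition Eform (k : T -> T -> R) (u v : T -> R) : \bar R :=
  \int[m]_x \int[m]_(y in [set y | y <> x])
     ((u x - u y) * (v x - v y) * ks k x y)%:E.

Definition Aform (k : T -> T -> R) (u v : T -> R) : \bar R :=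
  \int[m]_x \int[m]_(y in [set y | y <> x])
     ((u x - u y) * v y * ka k x y)%:E.

Definition Aform_abs (k : T -> T -> R) (u v : T -> R) : \bar R :=
  \int[m]_x \int[m]_(y in [set y | y <> x])
     (`|(u x - u y) * v y * ka k x y|)%:E.

Definition Ln (k : T -> T -> R) (n : nat) (u : T -> R) (x : T) : \bar R :=
  \int[m]_(y in [set y | (n%:R)^-1 < dist x y]) ((u y - u x) * k x y)%:E.

Definition eta_n (k : T -> T -> R) (n : nat) (u v : T -> R) : R :=
  - fine (\int[m]_x (fine (Ln k n u x) * v x)%:E).

Definition Fr (k : T -> T -> R) (u : T -> R) : Prop :=
  L2 u /\ (Eform k u u < +oo)%E.

Definition E1 (k : T -> T -> R) (u : T -> R) : \bar R :=
  (Eform k u u + \int[m]_x ((u x) ^+ 2)%:E)%E.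

Definition F0 (k : T -> T -> R) (u : T -> R) : Prop :=
  Fr k u /\ forall e : R, 0 < e ->
    exists w, Cc_lip w /\ (E1 k (u \- w)%R < e%:E)%E.

Definition fnorm (eta : (T -> R) -> (T -> R) -> R) (alpha : R) (u : T -> R) : R :=
  Num.sqrt (eta u u + alpha * ip u u).

Definition lb_semi_dirichlet (eta : (T -> R) -> (T -> R) -> R)
    (F : (T -> R) -> Prop) (alpha c : R) : Prop :=
  [/\ 0 < alpha /\ 0 < c,
      (forall u, F u -> L2 u) /\ F (fun _ => 0) /\
        (forall (a : R) u v, F u -> F v -> F (fun x => a * u x + v x)),
      [/\ (forall (a : R) u v w, F u -> F v -> F w ->
             eta (fun x => a * u x + v x) w = a * eta u w + eta v w),
          (forall (a : R) u v w, F u -> F v -> F w ->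
             eta w (fun x => a * u x + v x) = a * eta w u + eta w v) &
          (forall u u' v v', F u -> F u' -> F v -> F v' ->
             ae_eq u u' -> ae_eq v v' -> eta u v = eta u' v')],
      (forall u, F u -> eta u u >= - alpha * ip u u) /\
      (forall u v, F u -> F v ->
         eta u v <= c * fnorm eta alpha u * fnorm eta alpha v) &
      (forall s : nat -> T -> R, (forall n, F (s n)) ->
         (forall e : R, 0 < e -> exists N, forall p q, (N <= p)%N -> (N <= q)%N ->
             fnorm eta alpha (s p \- s q) < e) ->
         exists u, F u /\ (fun n => fnorm eta alpha (s n \- u)) @ \oo --> (0 : R))
      /\
      (forall u, F u ->
         let u' := fun x => Num.min (Num.max (u x) 0) 1 in
         F u' /\ 0 <= eta u' (u \- u'))].

Definition regular_form (eta : (T -> R) -> (T -> R) -> R)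
    (F : (T -> R) -> Prop) (alpha : R) : Prop :=
  (forall u, F u -> forall e : R, 0 < e ->
     exists g, F g /\ Cc g /\ fnorm eta alpha (u \- g) < e) /\
  (forall f, Cc f -> forall e : R, 0 < e ->
     exists g, F g /\ Cc g /\ forall x, `|f x - g x| < e).

End MetricMeasure.

(* Main.v *)
(**
Write [S], [A] for the symmetric and antisymmetric parts of the kernel on [E x E] (zero on the
diagonal), [grad u (x, y) = (u x - u y) sqrt (S (x, y))] and
[drift v (x, y) = v y A (x, y) / sqrt (S (x, y))].  In [L2 (m x m)] one has
[E(u, v) = <grad u, grad v>], the antisymmetric term is [<grad u, drift v>], and the second
hypothesis says precisely [|drift v|^2 <= C |v|^2].  Hence
[eta (u, v) = <grad u, grad v> / 2 + <grad u, drift v>] makes sense on the whole space of finite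
energy and the lower bound and the sector condition follow from Cauchy-Schwarz.  Completeness is
Fatou's lemma along an almost everywhere convergent subsequence; stability of the closure under
the unit contraction is a generalized dominated convergence.  Swapping the variables gives
[eta (u, v) = 1/2 \iint (u x - u y) (v x k (x, y) - v y k (y, x))], which yields both the
positivity of [eta (u^+ /\ 1, u - u^+ /\ 1)] (the integrand is nonnegative) and, with the
integrand cut off to [d (x, y) > 1/n], the convergence of [eta_n].
*)

Require Import Defs.
From HB Require Import structures.
From mathcomp Require Import all_boot all_order all_algebra.
From mathcomp Require Import all_classical all_reals all_analysis.
From mathcomp Require Import lebesgue_measure measurable_realfun.
From mathcomp Require Import unstable ring lra.
Import Order.TTheory GRing.Theory Num.Theory.
Import numFieldNormedType.Exports.
Local Open Scope classical_set_scope.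
Local Open Scope ring_scope.

Set Implicit Arguments.
Unset Strict Implicit.
Unset Printing Implicit Defensive.

(** * The space L2 *)

(** The obstacle to the convergence of [eta_n] is that its integrand [(u x - u y) v x k (x, y)] is
    in general only of first order in [d (x, y)] near the diagonal, while the first hypothesis
    controls second order: truncated, it is integrable, but with no majorant uniform in [n]. As long
    as the cut-off is present it may be averaged with its swapped copy, the set [d (x, y) > 1/n]
    being symmetric; the average is a truncated product of two functions in [L2 (m x m)], and that
    product is the majorant.

    The abstract part knows the kernel only through four facts: [S] is symmetric, [A] antisymmetric,
    [|A| <= S], and the integral of [A^2 / S] in one variable is bounded. The third expresses the
    nonnegativity of [k]: it makes [A] vanish where [S] does, and it makes the weights [S + A] and
    [S - A] in the contraction property nonnegative. The first hypothesis serves to give compactly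
    supported Lipschitz functions finite energy and to make the truncated integrals converge. *)

Section L2_theory.
Context (R : realType) (d : measure_display) (X : measurableType d).
Variable mu : {measure set X -> \bar R}.
Implicit Types f g h : X -> R.

Lemma L2_measurable f : L2 mu f -> measurable_fun setT f.
Proof. by case. Qed.

Lemma L2_sqr_integrable f : L2 mu f ->
  mu.-integrable setT (EFin \o (fun x => f x ^+ 2)).
Proof.
move=> [mf foo]; apply/integrableP; split.
  by apply/measurable_EFinP; exact: measurable_funX.
rewrite (le_lt_trans _ foo)// le_eqVlt; apply/orP; left; apply/eqP.
by apply: eq_integral => x _; rewrite /= ger0_norm// sqr_ge0.
Qed.

Lemma L2_mul_integrable f g : L2 mu f -> L2 mu g ->
  mu.-integrable setT (EFin \o (fun x => f x * g x)).
Proof.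
move=> Lf Lg; have [mf _] := Lf; have [mg _] := Lg.
apply: (@le_integrable _ _ _ _ _ measurableT _
    ((EFin \o (fun x => f x ^+ 2)%R) \+ (EFin \o (fun x => g x ^+ 2)%R))%E).
- by apply/measurable_EFinP; exact: measurable_funM.
- move=> x _ /=; rewrite lee_fin [leRHS]ger0_norm; last first.
    by rewrite addr_ge0// sqr_ge0.
  rewrite normrM -(real_normK (num_real (f x))) -(real_normK (num_real (g x))).
  have := normr_ge0 (f x); have := normr_ge0 (g x); nra.
- by apply: integrableD => //; exact: L2_sqr_integrable.
Qed.

Lemma sqr_integrable_L2 f : measurable_fun setT f ->
  mu.-integrable setT (EFin \o (fun x => f x ^+ 2)) -> L2 mu f.
Proof. by move=> mf fi; split => //; exact: integrable_lty fi. Qed.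

Lemma le_L2 f g : measurable_fun setT f -> (forall x, `|f x| <= `|g x|) ->
  L2 mu g -> L2 mu f.
Proof.
move=> mf fg Lg; apply: sqr_integrable_L2 => //.
apply: (le_integrable measurableT _ _ (L2_sqr_integrable Lg)) => //.
  by apply/measurable_EFinP; exact: measurable_funX.
by move=> x _ /=; rewrite lee_fin !normrX lerXn2r ?nnegrE.
Qed.

Lemma L2_0 : L2 mu (fun=> 0).
Proof.
split; first exact: measurable_cst.
by under eq_integral do rewrite expr0n; rewrite integral0.
Qed.

Lemma L2_comb a f g : L2 mu f -> L2 mu g -> L2 mu (fun x => a * f x + g x).
Proof.
move=> Lf Lg; have [mf _] := Lf; have [mg _] := Lg.
have mfg : measurable_fun setT (fun x => a * f x + g x).
  by apply: measurable_funD => //; apply: measurable_funM.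
apply: sqr_integrable_L2 => //.
apply: (@le_integrable _ _ _ _ _ measurableT _
   ((EFin \o (fun x => (2 * a ^+ 2) * f x ^+ 2)%R) \+ (EFin \o (fun x => 2 * g x ^+ 2)%R))%E).
- by apply/measurable_EFinP; exact: measurable_funX.
- move=> x _ /=; rewrite lee_fin !ger0_norm ?sqr_ge0//; last first.
    by have := sqr_ge0 (a * f x); have := sqr_ge0 (g x); rewrite exprMn; lra.
  by have := sqr_ge0 (a * f x - g x); lra.
- apply: integrableD => //.
    exact: (integrableZl measurableT (2 * a ^+ 2) (L2_sqr_integrable Lf)).
  exact: (integrableZl measurableT 2 (L2_sqr_integrable Lg)).
Qed.

Lemma L2_sub f g : L2 mu f -> L2 mu g -> L2 mu (f \- g).
Proof.
move=> Lf Lg; have := L2_comb (-1) Lg Lf.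
by congr (L2 mu _); apply/funext => x /=; rewrite mulN1r addrC.
Qed.

Lemma L2_scale a f : L2 mu f -> L2 mu (fun x => a * f x).
Proof.
move=> Lf; have := L2_comb a Lf L2_0.
by congr (L2 mu _); apply/funext => x /=; rewrite addr0.
Qed.

Lemma ipC f g : ip mu f g = ip mu g f.
Proof. by congr fine; apply: eq_integral => x _; rewrite mulrC. Qed.

Lemma ip_ge0 f : 0 <= ip mu f f.
Proof.
by apply/fine_ge0/integral_ge0 => x _; rewrite lee_fin -expr2 sqr_ge0.
Qed.

Lemma ip_sqrE f : L2 mu f -> (\int[mu]_x ((f x) ^+ 2)%:E = (ip mu f f)%:E)%E.
Proof.
move=> Lf; rewrite /ip; under [in RHS]eq_integral do rewrite -expr2.
by rewrite fineK//; apply: integrable_fin_num => //; exact: L2_sqr_integrable.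
Qed.

Lemma ip_combl a f g h : L2 mu f -> L2 mu g -> L2 mu h ->
  ip mu (fun x => a * f x + g x) h = a * ip mu f h + ip mu g h.
Proof.
move=> Lf Lg Lh; rewrite /ip.
have fh := L2_mul_integrable Lf Lh; have gh := L2_mul_integrable Lg Lh.
have -> : (\int[mu]_x ((a * f x + g x) * h x)%:E =
    \int[mu]_x (a%:E * (f x * h x)%:E + (g x * h x)%:E))%E.
  by apply: eq_integral => x _; rewrite -EFinM -EFinD; congr EFin; ring.
rewrite integralD//; last exact: integrableZl.
have fin1 := integrable_fin_num measurableT fh.
have fin2 := integrable_fin_num measurableT gh.
rewrite integralZl//= fineD//; first by rewrite fineM.
by rewrite fin_numM.
Qed.

Lemma ip_combr a f g h : L2 mu f -> L2 mu g -> L2 mu h ->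
  ip mu h (fun x => a * f x + g x) = a * ip mu h f + ip mu h g.
Proof. by move=> Lf Lg Lh; rewrite ipC ip_combl// !(ipC h). Qed.

Lemma ip_cauchy_schwarz f g : L2 mu f -> L2 mu g ->
  `|ip mu f g| <= Num.sqrt (ip mu f f) * Num.sqrt (ip mu g g).
Proof.
move=> Lf Lg; rewrite -sqrtrM ?ip_ge0// -sqrtr_sqr ler_wsqrtr//.
set a := ip mu f f; set b := ip mu f g; set c := ip mu g g.
have quad t : 0 <= t * (t * a) + 2 * (t * b) + c.
  have := ip_ge0 (fun x => t * f x + g x).
  rewrite ip_combl ?ip_combr//; try exact: L2_comb.
  by rewrite -/a (ipC g f) -/b -/c; lra.
have := ip_ge0 f; rewrite -/a le_eqVlt => /orP[/eqP a0|a0].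
  have [->|b0] := eqVneq b 0; first by rewrite expr0n/= mulr_ge0// ip_ge0.
  (* For [a = 0] the quadratic is affine in [t], and this [t] would give it the value [-1]. *)
  have := quad (- (c + 1) / (2 * b)); rewrite -a0 !mulr0 add0r.
  have -> : 2 * (- (c + 1) / (2 * b) * b) = - (c + 1) by field.
  by lra.
have := quad (- b / a).
have -> : - b / a * (- b / a * a) + 2 * (- b / a * b) + c = (a * c - b ^+ 2) / a.
  by field; rewrite gt_eqF.
by rewrite pmulr_lge0 ?invr_gt0//; lra.
Qed.


Lemma eq_ae_ip f f' g g' : L2 mu f -> L2 mu f' -> L2 mu g -> L2 mu g' ->
  {ae mu, forall x, f x = f' x} -> {ae mu, forall x, g x = g' x} ->
  ip mu f g = ip mu f' g'.
Proof.
move=> [mf _] [mf' _] [mg _] [mg' _] ff' gg'; congr fine.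
apply: ae_eq_integral => //; try by apply/measurable_EFinP/measurable_funM.
by apply: filterS2 ff' gg' => x -> ->.
Qed.

(** A triangle inequality for squared norms, so that energies are compared without square roots; the
    defect is the squared norm of [(h - g) - (f - h)]. *)
Lemma ip_sub_le f g h : L2 mu f -> L2 mu g -> L2 mu h ->
  ip mu (f \- g) (f \- g) <=
  2 * ip mu (f \- h) (f \- h) + 2 * ip mu (h \- g) (h \- g).
Proof.
move=> Lf Lg Lh; have Lfh := L2_sub Lf Lh; have Lhg := L2_sub Lh Lg.
have -> : f \- g = fun x => 1 * (f \- h) x + (h \- g) x.
  by apply/funext => x /=; lra.
have := ip_ge0 (fun x => (-1) * (f \- h) x + (h \- g) x).
rewrite !(ip_combl, ip_combr)//; try exact: L2_comb.
lra.
Qed.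

(* [\sum_n 4 ^ n * h_n ^ 2] has a finite integral, hence is finite almost everywhere. *)
Lemma L2_fast_decay (h : nat -> X -> R) : (forall n, L2 mu (h n)) ->
  (forall n, ip mu (h n) (h n) <= 8^-1 ^+ n) ->
  {ae mu, forall x, exists c, forall n, `|h n x| <= c * 2^-1 ^+ n}.
Proof.
move=> Lh hle; pose G x := (\sum_(n <oo) (4 ^+ n * h n x ^+ 2)%:E)%E.
have t0 n x : (0 <= (4 ^+ n * h n x ^+ 2)%:E)%E.
  by rewrite lee_fin mulr_ge0 ?sqr_ge0// exprn_ge0.
have mt n : measurable_fun setT (fun x => (4 ^+ n * h n x ^+ 2)%:E).
  by apply/measurable_EFinP/measurable_funM => //; apply/measurable_funX/(L2_measurable (Lh n)).
have G0 x : (0 <= G x)%E by apply: nneseries_ge0.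
have iG : mu.-integrable setT G.
  apply/integrableP; split; first by apply: ge0_emeasurable_sum.
  under eq_integral do rewrite gee0_abs//.
  (* [2] is the sum over [n] of [4 ^ n * 8 ^- n = 2 ^- n]. *)
  rewrite integral_nneseries//; apply: (@le_lt_trans _ _ 2%:E); last exact: ltry.
  apply: lime_le; first by apply: is_cvg_nneseries => n _ _; exact: integral_ge0.
  apply: nearW => n.
  apply: (@le_trans _ _ (series (geometric 1 2^-1) n)%:E); last first.
    rewrite lee_fin (le_trans (geometric_le_lim _ _ _ _))//; first by rewrite ger0_norm; lra.
    by rewrite div1r invf_ple ?posrE; lra.
  rewrite /series/= -sumEFin; apply: lee_sum => i _.
  under eq_integral do rewrite EFinM.
  rewrite ge0_integralZl_EFin//; last 2 first.
  - by move=> x _; rewrite lee_fin sqr_ge0.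
  - by apply/measurable_EFinP/measurable_funX/(L2_measurable (Lh i)).
  rewrite ip_sqrE// -EFinM lee_fin mul1r.
  have -> : (2^-1 : R) = 4 * 8^-1 by lra.
  by rewrite exprMn ler_wpM2l// exprn_ge0.
have := integrable_ae measurableT iG; apply: filterS => x /(_ I) Gfin.
exists (Num.sqrt (fine (G x))) => n.
have : ((4 ^+ n * h n x ^+ 2)%:E <= G x)%E.
  apply: le_trans (nneseries_lim_ge n.+1 _) => //.
  by rewrite big_nat_recr//= leeDr// sume_ge0.
rewrite -[X in (_ <= X)%E](fineK Gfin) lee_fin => le.
rewrite -(@ler_pXn2r _ 2) ?nnegrE// ?mulr_ge0 ?sqrtr_ge0// ?exprn_ge0//.
rewrite real_normK ?num_real// exprMn sqr_sqrtr; last exact/fine_ge0/G0.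
rewrite exprAC.
have -> : (2^-1 ^+ 2 : R) = 4^-1 by rewrite expr2; lra.
by rewrite exprVn ler_pdivlMr ?exprn_gt0// mulrC.
Qed.

Lemma geometric_steps_cvgn (u : nat -> R) c :
  (forall n, `|u n.+1 - u n| <= c * 2^-1 ^+ n) -> cvgn u.
Proof.
move=> uc; have -> : u = (fun n => u 0 + series (telescope u) n).
  by apply/funext => n; exact: eq_sum_telescope.
apply: is_cvgD; first exact: is_cvg_cst.
apply: normed_cvg; apply: (@series_le_cvg _ _ (geometric c 2^-1)) => //.
- by move=> n /=; exact: normr_ge0.
- by move=> n /=; exact: le_trans (normr_ge0 _) (uc n).
- by apply: is_cvg_geometric_series; rewrite ger0_norm; lra.
Qed.

Lemma geometric_decay_cvg0 (u : nat -> R) c :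
  (forall n, `|u n| <= c * 2^-1 ^+ n) -> u @ \oo --> 0.
Proof.
move=> uc; apply/norm_cvg0P.
apply: (@squeeze_cvgr _ _ _ _ (cst 0) (geometric c 2^-1)).
- by apply: nearW => n /=; rewrite normr_ge0 uc.
- exact: cvg_cst.
- by apply: cvg_geometric; rewrite ger0_norm; lra.
Qed.

Lemma L2_fast_cauchy_ae (f : nat -> X -> R) : (forall n, L2 mu (f n)) ->
  (forall n, ip mu (f n.+1 \- f n) (f n.+1 \- f n) <= 8^-1 ^+ n) ->
  exists g, measurable_fun setT g /\ {ae mu, forall x, f^~ x @ \oo --> g x}.
Proof.
(* The upper limit is measurable whether or not the sequence converges; [fine] replaces its infinite
   values by [0]. *)
move=> Lf fc; exists (fun x => fine (limn_esup (fun n => (f n x)%:E))); split.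
  apply/measurableT_comp => //.
  apply: (measurable_fun_limn_esup (f := fun n x => (f n x)%:E)) => n.
  exact/measurable_EFinP/(L2_measurable (Lf n)).
have := L2_fast_decay (fun n => L2_sub (Lf n.+1) (Lf n)) fc.
apply: filterS => x [c fxc]; have fx := geometric_steps_cvgn fxc.
have fxE : (fun n => (f n x)%:E) @ \oo --> (limn (f^~ x))%:E.
  by apply: cvg_EFin fx; apply: nearW.
by rewrite is_cvg_limn_esupE ?(cvg_lim _ fxE)//; apply/cvg_ex; eexists; exact: fxE.
Qed.

(** Fatou for the squares, with a bound on a tail only: in the completeness proof the Cauchy
    estimate starts at some rank. *)
Lemma L2_fatou (f : nat -> X -> R) g B : (forall n, L2 mu (f n)) ->
  measurable_fun setT g -> {ae mu, forall x, f^~ x @ \oo --> g x} ->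
  (\forall n \near \oo, ip mu (f n) (f n) <= B) -> L2 mu g /\ ip mu g g <= B.
Proof.
move=> Lf mg fg fB.
have mf2 n : measurable_fun setT (fun x => (f n x ^+ 2)%:E).
  by apply/measurable_EFinP/measurable_funX/(L2_measurable (Lf n)).
have : (\int[mu]_x (g x ^+ 2)%:E <= B%:E)%E.
  have -> : (\int[mu]_x (g x ^+ 2)%:E =
             \int[mu]_x limn_einf (fun n => (f n x ^+ 2)%:E))%E.
    apply: ae_eq_integral => //.
    - by apply/measurable_EFinP/measurable_funX.
    - under eq_fun do rewrite /limn_einf.
      apply: measurableT_comp => //; apply: measurable_fun_limn_esup => n.
      by apply: measurableT_comp.
    - apply: filterS fg => x fgx _.
      have fx : (fun n => (f n x ^+ 2)%:E) @ \oo --> (g x ^+ 2)%:E.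
        by apply: cvg_EFin; [exact: nearW|under eq_fun do rewrite /= expr2; exact: cvgM].
      by rewrite is_cvg_limn_einfE ?(cvg_lim _ fx)//; apply/cvg_ex; eexists; exact: fx.
  apply: le_trans (fatou mu measurableT mf2 _) _.
    by move=> n x _; rewrite lee_fin sqr_ge0.
  under eq_fun do rewrite ip_sqrE//.
  rewrite limn_einf_lim; apply: lime_le; first exact: is_cvg_einfs.
  case: fB => N _ NB; exists N => // n /= Nn.
  apply: (@le_trans _ _ (ip mu (f n) (f n))%:E).
    by apply: ereal_inf_lbound; exists n => /=.
  by rewrite lee_fin; apply: NB.
move=> gB; have Lg : L2 mu g by split => //; rewrite (le_lt_trans gB)// ltry.
by split => //; move: gB; rewrite ip_sqrE// lee_fin.
Qed.

(* Generalized dominated convergence: [(g_n - g)^2] exceeds [4 (f_n - f)^2] by at most [6 f^2]. *)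
Lemma L2_contraction_cvg (f g : nat -> X -> R) f0 g0 :
  (forall n, L2 mu (f n)) -> L2 mu f0 ->
  (forall n, measurable_fun setT (g n)) -> measurable_fun setT g0 ->
  (forall n x, `|g n x| <= `|f n x|) -> (forall x, `|g0 x| <= `|f0 x|) ->
  {ae mu, forall x, g^~ x @ \oo --> g0 x} ->
  (fun n => ip mu (f n \- f0) (f n \- f0)) @ \oo --> 0 ->
  (fun n => ip mu (g n \- g0) (g n \- g0)) @ \oo --> 0.
Proof.
move=> Lf Lf0 mg mg0 gf gf0 gg0 ff0.
have Lg n : L2 mu (g n) by apply: le_L2 (Lf n).
have Lg0 : L2 mu g0 by apply: le_L2 Lf0.
pose h n x := Num.max ((g n x - g0 x) ^+ 2 - 4 * (f n x - f0 x) ^+ 2) 0.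
have mh n : measurable_fun setT (h n).
  have mfn := L2_measurable (Lf n); have mf0 := L2_measurable Lf0.
  apply: measurable_maxr => //; apply: measurable_funB.
    by apply: measurable_funX; exact: measurable_funB.
  by apply: measurable_funM => //; apply: measurable_funX; exact: measurable_funB.
have h0 n x : 0 <= h n x by rewrite le_max lexx orbT.
have hle n x : h n x <= 6 * f0 x ^+ 2.
  rewrite ge_max; apply/andP; split; last by rewrite mulr_ge0// sqr_ge0.
  have := gf n x; have := gf0 x.
  rewrite -(@ler_pXn2r _ 2) ?nnegrE// !real_normK ?num_real// => gf0x.
  rewrite -(@ler_pXn2r _ 2) ?nnegrE// !real_normK ?num_real// => gfx.
  (* These squares are the defects in [(g n - g0)^2 <= 2 (g n)^2 + 2 g0^2] and
     [(f n)^2 <= 2 (f n - f0)^2 + 2 f0^2]. *)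
  have := sqr_ge0 (g n x + g0 x); have := sqr_ge0 (f n x - 2 * f0 x); nra.
have i6 : mu.-integrable setT (EFin \o (fun x => 6 * f0 x ^+ 2)).
  by apply: (integrableZl measurableT 6 (L2_sqr_integrable Lf0)).
have [|||//|//|ih _ hcvg] := @dominated_convergence _ _ _ mu setT measurableT
    (fun n => EFin \o h n) (cst 0%E) (EFin \o (fun x => 6 * f0 x ^+ 2)).
- by move=> n; exact/measurable_EFinP.
- exact: measurable_cst.
- apply: filterS gg0 => x gx _; apply: cvg_EFin; first exact: nearW.
  apply: (@squeeze_cvgr _ _ _ _ (cst 0) (fun n => (g n x - g0 x) * (g n x - g0 x))).
  + apply: nearW => n; rewrite h0/= ge_max -expr2 sqr_ge0 andbT.
    by rewrite lerBlDr lerDl mulr_ge0// sqr_ge0.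
  + exact: cvg_cst.
  + rewrite -[X in _ --> X](mulr0 0).
    have gg : (fun n => g n x - g0 x) @ \oo --> 0 by apply/subr_cvg0.
    exact: cvgM.
- by apply: nearW => x n _; rewrite /= lee_fin ger0_norm.
have ihn n : mu.-integrable setT (EFin \o h n).
  apply: le_integrable i6 => //; first exact/measurable_EFinP.
  by move=> x _ /=; rewrite lee_fin !ger0_norm// (le_trans (h0 n x)).
pose Ih n := fine (\int[mu]_x (h n x)%:E).
have Ih0 : Ih @ \oo --> 0.
  by apply: fine_cvg; rewrite /= integral0 in hcvg; exact: hcvg.
apply: (@squeeze_cvgr _ _ _ _ (cst 0)
    (fun n => Ih n + 4 * ip mu (f n \- f0) (f n \- f0))).
- apply: nearW => n /=; rewrite ip_ge0 /=.
  have Lgn := L2_sub (Lg n) Lg0; have Lfn := L2_sub (Lf n) Lf0.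
  have IhE : (Ih n)%:E = (\int[mu]_x (h n x)%:E)%E.
    by rewrite fineK//; exact: (integrable_fin_num measurableT (ihn n)).
  rewrite -lee_fin EFinD EFinM IhE.
  have i4 := integrableZl measurableT 4 (L2_sqr_integrable Lfn).
  rewrite -(ip_sqrE Lgn) -(ip_sqrE Lfn) -integralZl//; last exact: L2_sqr_integrable.
  rewrite -integralD//; last exact: ihn.
  apply: le_integral => //.
  + exact: L2_sqr_integrable.
  + by apply: integrableD => //; exact: ihn.
  + by move=> x _; rewrite -EFinM -EFinD lee_fin /= -lerBlDr le_max lexx.
- exact: cvg_cst.
- rewrite -[X in _ --> X](addr0 0); apply: cvgD => //.
  by rewrite -[X in _ --> X](mulr0 4); exact: cvgMr.
Qed.

End L2_theory.

(** * Jump forms *)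

Lemma measurable_invr (R : realType) : measurable_fun setT (@GRing.inv R).
Proof.
rewrite -(setvU [set (0 : R)]); apply/measurable_funU => //.
  exact: measurableC.
split; last exact: measurable_fun_set1.
apply: open_continuous_measurable_fun.
  exact: closed_openC.
by move=> x; rewrite inE /= => /eqP x0; exact: inv_continuous.
Qed.

Lemma measurable_sqrt (R : realType) : measurable_fun setT (@Num.sqrt R).
Proof. by apply: continuous_measurable_fun; exact: sqrt_continuous. Qed.

(** * Exchange of the variables in the product measure *)

Section product_measure.
Context (R : realType) (d : measure_display) (T : measurableType d).
Variable m : {sigma_finite_measure set T -> \bar R}.
Local Notation M := (m \x m)%E.

Lemma ae_fst (P : T -> Prop) : {ae m, forall x, P x} -> {ae M, forall z, P z.1}.
Proof.
move=> [N [mN mN0 PN]]; exists (N `*` setT); split.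
- exact: measurableX.
- rewrite product_measure1E//; apply: etrans (congr1 (fun t => t * _)%E mN0) _.
  exact: mul0e.
- by move=> z /= Pz; split => //; exact: PN.
Qed.

Lemma ae_snd (P : T -> Prop) : {ae m, forall x, P x} -> {ae M, forall z, P z.2}.
Proof.
move=> [N [mN mN0 PN]]; exists (setT `*` N); split.
- exact: measurableX.
- by rewrite product_measure1E// mN0 mule0.
- by move=> z /= Pz; split => //; exact: PN.
Qed.

(** An iterated integral of [f \o swap] in one order is that of [f] in the other, so Tonelli in both
    orders replaces a proof that [swap] preserves [m \x m]. *)
Lemma integrable_swap (f : T * T -> \bar R) :
  M.-integrable setT f -> M.-integrable setT (f \o swap).
Proof.
move=> intf; have mf := measurable_int _ intf.
apply/integrable12ltyP; first exact: measurableT_comp (@measurable_swap _ _ T T).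
exact: (integrable21ltyP _ _ mf).1.
Qed.

Lemma integral_swap (f : T * T -> \bar R) : M.-integrable setT f ->
  (\int[M]_z f z = \int[M]_z f (swap z))%E.
Proof.
move=> intf; rewrite -integral21_prod_meas1//.
by rewrite -(integral12_prod_meas1 (integrable_swap intf)).
Qed.

Lemma L2_swap (f : T * T -> R) : L2 M f -> L2 M (f \o swap).
Proof.
move=> Lf; have [mf _] := Lf; apply: sqr_integrable_L2.
  exact: measurableT_comp (@measurable_swap _ _ T T).
exact: integrable_swap (L2_sqr_integrable Lf).
Qed.

Lemma ip_swap (f g : T * T -> R) : L2 M f -> L2 M g ->
  ip M f g = ip M (f \o swap) (g \o swap).
Proof.
by move=> Lf Lg; rewrite /ip (integral_swap (L2_mul_integrable Lf Lg)).
Qed.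

End product_measure.

(** * The unit contraction of the real line *)

Section unit_cut.
Context {R : realType}.
Implicit Types s t : R.

Definition unit_cut t : R := Num.min (Num.max t 0) 1.

Variant unit_cut_spec t : R -> Type :=
  | UnitCutNeg of t < 0 : unit_cut_spec t 0
  | UnitCutId of 0 <= t <= 1 : unit_cut_spec t t
  | UnitCutOne of 1 < t : unit_cut_spec t 1.

Lemma unit_cutP t : unit_cut_spec t (unit_cut t).
Proof.
rewrite /unit_cut; case: (leP 0 t) => t0.
  case: (leP t 1) => t1; first by constructor; rewrite t0.
  by constructor.
by rewrite min_l; [constructor|exact: ler01].
Qed.

Lemma unit_cut_le t : `|unit_cut t| <= `|t|.
Proof.
case: unit_cutP => [t0|//|t1]; first by rewrite normr0.
by rewrite normr1 ger0_norm; lra.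
Qed.

Lemma unit_cut_dist s t : `|unit_cut s - unit_cut t| <= `|s - t|.
Proof.
have := ler_norm (s - t); have := ler_norm (t - s); rewrite distrC ler_norml.
by case: (unit_cutP s) => [?|/andP[? ?]|?]; case: (unit_cutP t) => [?|/andP[? ?]|?] *;
  apply/andP; split; lra.
Qed.

(** [s - unit_cut s] is positive only where [unit_cut s] takes its maximum [1], and negative only
    where it takes its minimum [0]. *)
Lemma unit_cut_sign s t : 0 <= (unit_cut s - unit_cut t) * (s - unit_cut s).
Proof.
have [t0 t1] : 0 <= unit_cut t /\ unit_cut t <= 1.
  by case: (unit_cutP t) => [?|/andP[? ?]|?]; split; lra.
case: (unit_cutP s) => [s0|_|s1]; last 2 first.
- by rewrite subrr mulr0.
- by rewrite mulr_ge0//; lra.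
by rewrite mulr_le0//; lra.
Qed.

End unit_cut.

(** * The form on functions of finite energy: bounds, sector condition, symmetrization *)

Section jump_form.
Context (R : realType) (d : measure_display) (T : measurableType d).
Variable m : {sigma_finite_measure set T -> \bar R}.
Variables (S A : T * T -> R) (C : R).
Hypothesis mS : measurable_fun setT S.
Hypothesis mA : measurable_fun setT A.
Hypothesis S_swap : forall z, S (swap z) = S z.
Hypothesis A_swap : forall z, A (swap z) = - A z.
Hypothesis A_le_S : forall z, `|A z| <= S z.
Hypothesis C_ge0 : 0 <= C.
Hypothesis A2S_le : forall x, (\int[m]_y ((A (x, y) ^+ 2) / S (x, y))%:E <= C%:E)%E.
Local Notation M := (m \x m)%E.
Implicit Types u v w : T -> R.

Definition grad u (z : T * T) : R := (u z.1 - u z.2) * Num.sqrt (S z).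
Definition drift v (z : T * T) : R := v z.2 * (A z / Num.sqrt (S z)).
Definition jump_form u v : R :=
  2^-1 * ip M (grad u) (grad v) + ip M (grad u) (drift v).
(** The real-valued counterpart of [E1]; because of the [fine] in [ip] it is meaningful only under
    [finite_energy]. *)
Definition energy u : R := ip M (grad u) (grad u) + ip m u u.
Definition finite_energy u : Prop := L2 m u /\ L2 M (grad u).

Let S_ge0 z : 0 <= S z.
Proof. exact: le_trans (A_le_S z). Qed.

(** Dividing by [sqrt S] loses nothing: by [|A| <= S], [A] vanishes wherever [S] does. *)
Lemma sqrtS_drift z : Num.sqrt (S z) * (A z / Num.sqrt (S z)) = A z.
Proof.
have [S0|S0] := eqVneq (S z) 0.
  have := A_le_S z; rewrite S0 normr_le0 => /eqP ->.
  by rewrite mul0r mulr0.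
by rewrite mulrC divfK// sqrtr_eq0 -ltNge lt_def S0 S_ge0.
Qed.

Lemma grad_gradE u v z :
  grad u z * grad v z = (u z.1 - u z.2) * (v z.1 - v z.2) * S z.
Proof.
rewrite /grad mulrACA -[in LHS]expr2 sqr_sqrtr//.
Qed.

Lemma grad_driftE u v z : grad u z * drift v z = (u z.1 - u z.2) * v z.2 * A z.
Proof. by rewrite /grad /drift mulrACA sqrtS_drift. Qed.

Lemma grad0 : grad (fun=> 0) = fun=> 0.
Proof. by apply/funext => z; rewrite /grad subrr mul0r. Qed.

Lemma grad_comb a u v :
  grad (fun x => a * u x + v x) = fun z => a * grad u z + grad v z.
Proof. by apply/funext => z; rewrite /grad; ring. Qed.

Lemma grad_sub u v : grad (u \- v) = grad u \- grad v.
Proof. by apply/funext => z; rewrite /grad /=; ring. Qed.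

Lemma drift_comb a u v :
  drift (fun x => a * u x + v x) = fun z => a * drift u z + drift v z.
Proof. by apply/funext => z; rewrite /drift; ring. Qed.

Lemma grad_swap u : grad u \o swap = fun z => - grad u z.
Proof.
by apply/funext => z; rewrite /grad /= S_swap; case: z => x y /=; ring.
Qed.

Lemma measurable_grad u : measurable_fun setT u -> measurable_fun setT (grad u).
Proof.
move=> mu; apply: measurable_funM.
  by apply: measurable_funB; apply: measurableT_comp.
exact: (measurableT_comp (@measurable_sqrt R)).
Qed.

Let mkernel : measurable_fun setT (fun z => A z / Num.sqrt (S z)).
Proof.
apply: measurable_funM => //.
apply: (measurableT_comp (@measurable_invr R)).
exact: (measurableT_comp (@measurable_sqrt R)).
Qed.

Lemma measurable_drift u : measurable_fun setT u -> measurable_fun setT (drift u).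
Proof.
by move=> mu; apply: measurable_funM; [exact: measurableT_comp|exact: mkernel].
Qed.

Let drift_sqr v z : drift v z ^+ 2 = v z.2 ^+ 2 * (A z ^+ 2 / S z).
Proof. by rewrite /drift !exprMn exprVn sqr_sqrtr. Qed.

(** Tonelli with the first variable inside: [v z.2] comes out of the inner integral, and since
    [A ^ 2 / S] is invariant under [swap], the bound on its integral in the second variable
    applies. *)
Lemma drift_L2_le v : L2 m v ->
  L2 M (drift v) /\ ip M (drift v) (drift v) <= C * ip m v v.
Proof.
move=> Lv; have [mv _] := Lv; have mb := measurable_drift mv.
have mq : measurable_fun setT (fun z => A z ^+ 2 / S z).
  apply: measurable_funM => //; first exact: measurable_funX.
  exact: (measurableT_comp (@measurable_invr R)).
have le : (\int[M]_z (drift v z ^+ 2)%:E <= (C * ip m v v)%:E)%E.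
  rewrite fubini_tonelli2; last 2 first.
  - by apply/measurable_EFinP/measurable_funX.
  - by move=> z; rewrite lee_fin sqr_ge0.
  rewrite /fubini_G EFinM -ip_sqrE// -ge0_integralZl_EFin//; last 2 first.
  - by move=> x _; rewrite lee_fin sqr_ge0.
  - by apply/measurable_EFinP/measurable_funX.
  apply: ge0_le_integral => //.
  - by move=> y _; apply: integral_ge0 => x _; rewrite lee_fin sqr_ge0.
  - apply: (measurable_fun_fubini_tonelli_G (fun z => (drift v z ^+ 2)%:E)).
      by apply/measurable_EFinP/measurable_funX.
    by move=> z; rewrite lee_fin sqr_ge0.
  - by apply/measurable_EFinP; apply: measurable_funM => //; exact: measurable_funX.
  move=> y _; under eq_integral do rewrite drift_sqr EFinM /=.
  rewrite ge0_integralZl_EFin//; last 3 first.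
  - by move=> x _; rewrite lee_fin divr_ge0// sqr_ge0.
  - by apply/measurable_EFinP; apply: measurableT_comp mq _; exact: measurable_fun_pair.
  - exact: sqr_ge0.
  rewrite muleC; apply: lee_wpmul2r; first by rewrite lee_fin sqr_ge0.
  apply: le_trans (A2S_le y).
  rewrite le_eqVlt; apply/orP; left; apply/eqP.
  apply: eq_integral => x _.
  by rewrite -[(x, y)]/(swap (y, x)) A_swap S_swap sqrrN.
have Lb : L2 M (drift v) by split => //; rewrite (le_lt_trans le)// ltry.
by split => //; rewrite -lee_fin -ip_sqrE.
Qed.

Lemma L2_drift v : L2 m v -> L2 M (drift v).
Proof. by case/drift_L2_le. Qed.

Lemma finite_energy_measurable u : finite_energy u -> measurable_fun setT u.
Proof. by case=> -[]. Qed.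

Lemma finite_energy_comb a u v : finite_energy u -> finite_energy v ->
  finite_energy (fun x => a * u x + v x).
Proof.
by move=> [Lu Du] [Lv Dv]; split; rewrite ?grad_comb; exact: L2_comb.
Qed.

Lemma finite_energy_sub u v : finite_energy u -> finite_energy v ->
  finite_energy (u \- v).
Proof. by move=> [Lu Du] [Lv Dv]; split; rewrite ?grad_sub; exact: L2_sub. Qed.

Lemma finite_energy_contraction u v : measurable_fun setT v ->
  (forall x, `|v x| <= `|u x|) ->
  (forall x y, `|v x - v y| <= `|u x - u y|) ->
  finite_energy u -> finite_energy v.
Proof.
move=> mv vu dvu [Lu Du]; split; first exact: le_L2 Lu.
apply: le_L2 Du; first exact: measurable_grad.
by move=> z; rewrite !normrM ler_wpM2r.
Qed.

Lemma energy_ge0 u : 0 <= energy u.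
Proof. by rewrite addr_ge0// ip_ge0. Qed.

Lemma ip_le_energy u : ip m u u <= energy u.
Proof. by rewrite lerDr ip_ge0. Qed.

Lemma ip_grad_le_energy u : ip M (grad u) (grad u) <= energy u.
Proof. by rewrite lerDl ip_ge0. Qed.

Lemma energy_sub_le u v w : finite_energy u -> finite_energy v ->
  finite_energy w ->
  energy (u \- v) <= 2 * energy (u \- w) + 2 * energy (w \- v).
Proof.
move=> [Lu Du] [Lv Dv] [Lw Dw]; rewrite /energy !grad_sub.
have := ip_sub_le Lu Lv Lw; have := ip_sub_le Du Dv Dw; lra.
Qed.

Lemma energy_subC u v : energy (u \- v) = energy (v \- u).
Proof.
rewrite /energy /ip; congr (_ + _); congr fine; apply: eq_integral => z _;
  by rewrite /grad /=; congr EFin; ring.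
Qed.

Lemma energy_comb_le a u v : finite_energy u -> finite_energy v ->
  energy (fun x => a * u x + v x) <= 2 * a ^+ 2 * energy u + 2 * energy v.
Proof.
move=> [Lu Du] [Lv Dv]; rewrite /energy grad_comb.
have key (d' : measure_display) (X : measurableType d')
    (mu : {measure set X -> \bar R}) (f g : X -> R) : L2 mu f -> L2 mu g ->
    ip mu (fun x => a * f x + g x) (fun x => a * f x + g x) <=
    2 * a ^+ 2 * ip mu f f + 2 * ip mu g g.
  move=> Lf Lg; have := ip_ge0 mu (fun x => (- a) * f x + g x).
  rewrite !(ip_combl, ip_combr)//; try exact: L2_comb.
  lra.
have := key _ _ _ _ _ Lu Lv; have := key _ _ _ _ _ Du Dv; lra.
Qed.

Let ip_drift_le u v : finite_energy u -> L2 m v ->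
  `|ip M (grad u) (drift v)| <=
    Num.sqrt (ip M (grad u) (grad u)) * (Num.sqrt C * Num.sqrt (ip m v v)).
Proof.
move=> [Lu Du] Lv; have [Lb bC] := drift_L2_le Lv.
apply: le_trans (ip_cauchy_schwarz Du Lb) _.
by apply: ler_wpM2l; rewrite ?sqrtr_ge0// -sqrtrM// ler_wsqrtr.
Qed.

(** Cauchy-Schwarz bounds the drift term by [sqrt e * sqrt C * sqrt l]. The weights in the
    arithmetic-geometric inequality are chosen to spend only half of the leading term [e / 2], at
    the price [C * l]. *)
Let jump_form_diag u : finite_energy u ->
  `|jump_form u u - 2^-1 * ip M (grad u) (grad u)| <=
   4^-1 * ip M (grad u) (grad u) + C * ip m u u.
Proof.
move=> Hu; have [Lu Du] := Hu; rewrite /jump_form addrC addKr.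
apply: le_trans (ip_drift_le Hu Lu) _.
set e := ip M _ _; have e0 : 0 <= e := ip_ge0 _ _.
set l := ip m _ _; have l0 : 0 <= l := ip_ge0 _ _.
rewrite -{2}(sqr_sqrtr e0) -{2}(sqr_sqrtr l0) -{2}(sqr_sqrtr C_ge0).
have := sqr_ge0 (2^-1 * Num.sqrt e - Num.sqrt C * Num.sqrt l); lra.
Qed.

(** [C] compensates the drift and the extra [1] restores the L2 part of the energy, whence
    [alpha = C + 1]. With [jump_form_upper] this makes the form norm equivalent to the energy norm,
    in which completeness and density are then proved. *)
Lemma jump_form_lower u : finite_energy u ->
  4^-1 * energy u <= jump_form u u + (C + 1) * ip m u u.
Proof.
move=> Hu; have := jump_form_diag Hu; rewrite ler_norml => /andP[+ _].
by have := ip_ge0 m u; rewrite /energy; lra.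
Qed.

Lemma jump_form_upper u : finite_energy u ->
  jump_form u u + (C + 1) * ip m u u <= (2 * C + 2) * energy u.
Proof.
move=> Hu; have := jump_form_diag Hu; rewrite ler_norml => /andP[_].
have := ip_ge0 m u; have := ip_ge0 M (grad u); rewrite /energy; move: C_ge0.
by nra.
Qed.

Local Notation nrm := (fnorm m jump_form (C + 1)).

Lemma energy_le_fnorm u : finite_energy u -> energy u <= 4 * nrm u ^+ 2.
Proof.
move=> Hu; have lo := jump_form_lower Hu; have e0 := energy_ge0 u.
by rewrite /fnorm sqr_sqrtr; lra.
Qed.

Lemma fnorm_le_energy u : finite_energy u ->
  nrm u <= Num.sqrt ((2 * C + 2) * energy u).
Proof. by move=> Hu; rewrite ler_wsqrtr// jump_form_upper. Qed.

Lemma jump_form_lower_bounded u : finite_energy u ->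
  jump_form u u >= - (C + 1) * ip m u u.
Proof.
by move=> Hu; have := jump_form_lower Hu; have := energy_ge0 u; lra.
Qed.

(** [energy_le_fnorm] bounds each L2 norm involved by twice the form norm: the symmetric part
    contributes [4 / 2 = 2], the drift [4 * sqrt C]. *)
Lemma jump_form_sector u v : finite_energy u -> finite_energy v ->
  jump_form u v <= (2 + 4 * Num.sqrt C) * nrm u * nrm v.
Proof.
move=> Hu Hv; have [Lu Du] := Hu; have [Lv Dv] := Hv.
have bound w e : finite_energy w -> e <= energy w -> Num.sqrt e <= 2 * nrm w.
  move=> Hw le; rewrite -(@ger0_norm _ (2 * nrm w)) ?mulr_ge0 ?sqrtr_ge0//.
  rewrite -sqrtr_sqr ler_wsqrtr// exprMn.
  by have := energy_le_fnorm Hw; lra.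
have bu := bound _ _ Hu (ip_grad_le_energy u).
have bv := bound _ _ Hv (ip_grad_le_energy v).
have bl := bound _ _ Hv (ip_le_energy v).
have gg : ip M (grad u) (grad v) <= 2 * nrm u * (2 * nrm v).
  apply: le_trans (ler_norm _) _; apply: le_trans (ip_cauchy_schwarz Du Dv) _.
  by apply: ler_pM => //; exact: sqrtr_ge0.
have gd : ip M (grad u) (drift v) <= 2 * nrm u * (Num.sqrt C * (2 * nrm v)).
  apply: le_trans (ler_norm _) _; apply: le_trans (ip_drift_le Hu Lv) _.
  apply: ler_pM => //; rewrite ?mulr_ge0 ?sqrtr_ge0//.
  by rewrite ler_wpM2l ?sqrtr_ge0.
rewrite /jump_form; lra.
Qed.


Lemma jump_form_combl a u v w : finite_energy u -> finite_energy v ->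
  finite_energy w ->
  jump_form (fun x => a * u x + v x) w = a * jump_form u w + jump_form v w.
Proof.
move=> [Lu Du] [Lv Dv] [Lw Dw]; rewrite /jump_form grad_comb.
rewrite !ip_combl//; last exact: L2_drift.
ring.
Qed.

Lemma jump_form_combr a u v w : finite_energy u -> finite_energy v ->
  finite_energy w ->
  jump_form w (fun x => a * u x + v x) = a * jump_form w u + jump_form w v.
Proof.
move=> [Lu Du] [Lv Dv] [Lw Dw]; rewrite /jump_form grad_comb drift_comb.
rewrite !ip_combr//; try exact: L2_drift.
ring.
Qed.

Lemma eq_ae_jump_form u u' v v' : finite_energy u -> finite_energy u' ->
  finite_energy v -> finite_energy v' ->
  {ae m, forall x, u x = u' x} -> {ae m, forall x, v x = v' x} ->
  jump_form u v = jump_form u' v'.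
Proof.
move=> [Lu Du] [Lu' Du'] [Lv Dv] [Lv' Dv'] uu' vv'.
have grad_ae w w' : {ae m, forall x, w x = w' x} ->
    {ae M, forall z, grad w z = grad w' z}.
  move=> ww'; apply: filterS2 (ae_fst ww') (ae_snd ww') => z.
  by rewrite /grad => -> ->.
have drift_ae : {ae M, forall z, drift v z = drift v' z}.
  by apply: filterS (ae_snd vv') => z; rewrite /drift => ->.
congr (_ * _ + _); apply: eq_ae_ip => //; by [exact: grad_ae|exact: L2_drift].
Qed.

(** [grad u] and [A / sqrt S] both change sign under [swap], so the two signs cancel and only [v]
    sees the exchange. *)
Lemma ip_drift_swap u v : finite_energy u -> L2 m v ->
  ip M (grad u) (drift v) =
    ip M (grad u) (fun z => v z.1 * (A z / Num.sqrt (S z))).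
Proof.
move=> [Lu Du] Lv; rewrite ip_swap//; last exact: L2_drift.
rewrite grad_swap /ip; congr fine; apply: eq_integral => z _.
by rewrite /drift /= S_swap A_swap; congr EFin; ring.
Qed.

(** Its product with [grad u] is [(u x - u y) (v x k (x, y) - v y k (y, x))], since [S + A] is [k]
    and [S - A] is [k] with its variables exchanged. *)
Definition sym_drift v (z : T * T) : R :=
  (v z.1 - v z.2) * Num.sqrt (S z) + (v z.1 + v z.2) * (A z / Num.sqrt (S z)).

Let sym_driftE v : sym_drift v =
  fun z => 1 * grad v z + (1 * drift v z + v z.1 * (A z / Num.sqrt (S z))).
Proof. by apply/funext => z; rewrite /sym_drift /grad /drift; ring. Qed.

Let L2_drift1 v : L2 m v -> L2 M (fun z => v z.1 * (A z / Num.sqrt (S z))).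
Proof.
move=> Lv; have := L2_swap (L2_scale (-1) (L2_drift Lv)); congr (L2 _ _).
by apply/funext => z; rewrite /drift /= S_swap A_swap; ring.
Qed.

Lemma L2_sym_drift v : finite_energy v -> L2 M (sym_drift v).
Proof.
move=> [Lv Dv]; rewrite sym_driftE; apply: L2_comb => //.
by apply: L2_comb; [exact: L2_drift|exact: L2_drift1].
Qed.

Lemma jump_form_symmetrized u v : finite_energy u -> finite_energy v ->
  jump_form u v = 2^-1 * ip M (grad u) (sym_drift v).
Proof.
move=> Hu Hv; have [Lu Du] := Hu; have [Lv Dv] := Hv.
have Lb := L2_drift Lv; have Lb1 := L2_drift1 Lv.
rewrite sym_driftE !ip_combr//; last exact: L2_comb.
by rewrite -ip_drift_swap// /jump_form; lra.
Qed.

Lemma grad_sym_driftE u v z : grad u z * sym_drift v z =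
  (u z.1 - u z.2) * (v z.1 * (S z + A z) - v z.2 * (S z - A z)).
Proof.
have := sqrtS_drift z.
have : Num.sqrt (S z) * Num.sqrt (S z) = S z by rewrite -expr2 sqr_sqrtr.
by rewrite /grad /sym_drift; move: (Num.sqrt (S z)) (A z / _) => q r <- <-; ring.
Qed.

(** The integrand is [p a (S + A) - p b (S - A)]; [unit_cut_sign] at [(x, y)] and at [(y, x)] gives
    [0 <= p a] and [p b <= 0], and [|A| <= S] makes both weights nonnegative. *)
Lemma jump_form_cut_ge0 u v : finite_energy u -> finite_energy v ->
  (forall x, v x = unit_cut (u x)) ->
  0 <= jump_form v (u \- v).
Proof.
move=> Hu Hv vE; have Hw := finite_energy_sub Hu Hv.
rewrite jump_form_symmetrized// mulr_ge0// /ip; apply/fine_ge0/integral_ge0.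
move=> z _; rewrite lee_fin grad_sym_driftE mulrBr !mulrA.
set p := v z.1 - v z.2; set a := (u \- v) z.1; set b := (u \- v) z.2.
have sgn x y : 0 <= (v x - v y) * (u x - v x) by rewrite !vE unit_cut_sign.
have pa : 0 <= p * a := sgn _ _.
have pb : p * b <= 0 by rewrite -oppr_ge0 -mulNr opprB; exact: sgn.
have := A_le_S z; rewrite ler_norml => /andP[AS SA].
have := mulr_ge0 pa (_ : 0 <= S z + A z); have := mulr_le0_ge0 pb (_ : 0 <= S z - A z).
by move=> h1 h2; have := h1 ltac:(lra); have := h2 ltac:(lra); lra.
Qed.

(** * Closure of a linear core stable under the unit contraction *)

Section closure.
Variable core : (T -> R) -> Prop.
Hypothesis core_finite_energy : forall w, core w -> finite_energy w.
Hypothesis core0 : core (fun=> 0).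
Hypothesis core_comb : forall a w w', core w -> core w' ->
  core (fun x => a * w x + w' x).
Hypothesis core_cut : forall w, core w -> core (fun x => unit_cut (w x)).

Definition energy_closure u : Prop := finite_energy u /\
  forall e : R, 0 < e -> exists w, core w /\ energy (u \- w) < e.
Local Notation F := energy_closure.

Lemma core_closure w : core w -> F w.
Proof.
move=> cw; split; first exact: core_finite_energy.
move=> e e0; exists w; split => //.
have -> : w \- w = (fun=> 0) by apply/funext => x /=; rewrite subrr.
by rewrite /energy /ip grad0 mul0r !integral0 addr0.
Qed.

Lemma closure_comb a u v : F u -> F v -> F (fun x => a * u x + v x).
Proof.
move=> [Hu Au] [Hv Av]; split; first exact: finite_energy_comb.
move=> e e0.
have e1 : 0 < e / (4 * a ^+ 2 + 4).
  by rewrite divr_gt0//; have := sqr_ge0 a; lra.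
have [w [cw wu]] := Au _ e1; have [w' [cw' wv]] := Av _ e1.
exists (fun x => a * w x + w' x); split; first exact: core_comb.
have Huw := finite_energy_sub Hu (core_finite_energy cw).
have Hvw := finite_energy_sub Hv (core_finite_energy cw').
have -> : (fun x => a * u x + v x) \- (fun x => a * w x + w' x) =
    fun x => a * (u \- w) x + (v \- w') x by apply/funext => x /=; ring.
apply: le_lt_trans (energy_comb_le a Huw Hvw) _.
rewrite ltr_pdivlMr in wu; last by have := sqr_ge0 a; lra.
rewrite ltr_pdivlMr in wv; last by have := sqr_ge0 a; lra.
have := energy_ge0 (u \- w); have := energy_ge0 (v \- w'); have := sqr_ge0 a.
nra.
Qed.

(** The rate [8 ^- n] is the one at which [L2_fast_decay] turns convergence in norm into convergence
    almost everywhere. *)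
Lemma closure_fast_core u : F u -> exists w : nat -> T -> R,
  (forall n, core (w n)) /\ (forall n, energy (w n \- u) <= 8^-1 ^+ n).
Proof.
move=> [Hu Au].
have /choice[w wP] : forall n : nat, exists w, core w /\ energy (w \- u) <= 8^-1 ^+ n.
  move=> n; have [|w [cw wu]] := Au (8^-1 ^+ n); first by rewrite exprn_gt0.
  by exists w; split => //; rewrite energy_subC ltW.
by exists w; split => n; have [] := wP n.
Qed.

Let expr8_cvg0 : (fun n => (8^-1 : R) ^+ n) @ \oo --> 0.
Proof.
rewrite exprn_geometric; apply: cvg_geometric.
by rewrite ger0_norm; lra.
Qed.

(** The cut is not linear, so the gradient of [unit_cut (w n) - unit_cut u] is not dominated by that
    of [w n - u]. Each cut separately has a smaller gradient than its argument, which is what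
    [L2_contraction_cvg] asks for; it is applied to the functions and then to their gradients. *)
Lemma closure_cut u : F u -> F (fun x => unit_cut (u x)).
Proof.
move=> Fu; have [Hu _] := Fu; have [w [cw wu]] := closure_fast_core Fu.
have Hw n := core_finite_energy (cw n).
have mcut v : measurable_fun setT v -> measurable_fun setT (fun x => unit_cut (v x)).
  by move=> mv; apply: measurable_minr => //; apply: measurable_maxr.
have Hcut v : finite_energy v -> finite_energy (fun x => unit_cut (v x)).
  move=> Hv; apply: (finite_energy_contraction _ _ _ Hv) => [|x|x y].
  - exact/mcut/finite_energy_measurable.
  - exact: unit_cut_le.
  - exact: unit_cut_dist.
split; first exact: Hcut.
have cutE v z : `|grad (fun x => unit_cut (v x)) z| <= `|grad v z|.
  by rewrite /grad !normrM ler_wpM2r// unit_cut_dist.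
have w_ae : {ae m, forall x, w^~ x @ \oo --> u x}.
  have Lwu n : L2 m (w n \- u) := (finite_energy_sub (Hw n) Hu).1.
  have := L2_fast_decay Lwu (fun n => le_trans (ip_le_energy _) (wu n)).
  by apply: filterS => x [c /geometric_decay_cvg0] /subr_cvg0.
have cutw_ae : {ae m, forall x, (fun n => unit_cut (w n x)) @ \oo --> unit_cut (u x)}.
  apply: filterS w_ae => x wx; apply/subr_cvg0/norm_cvg0P.
  apply: (@squeeze_cvgr _ _ _ _ (cst 0) (fun n => `|w n x - u x|)).
  - by apply: nearW => n /=; rewrite normr_ge0 unit_cut_dist.
  - exact: cvg_cst.
  - exact/norm_cvg0P/subr_cvg0.
have le_cvg0 (q : nat -> R) : (forall n, 0 <= q n <= energy (w n \- u)) -> q @ \oo --> 0.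
  move=> qle; apply: (@squeeze_cvgr _ _ _ _ (cst 0) (fun n => 8^-1 ^+ n)).
  - by apply: nearW => n; have /andP[-> /=] := qle n; move/le_trans; apply.
  - exact: cvg_cst.
  - exact: expr8_cvg0.
have cv1 : (fun n => ip m ((unit_cut \o w n) \- (unit_cut \o u))
    ((unit_cut \o w n) \- (unit_cut \o u))) @ \oo --> 0.
  apply: (L2_contraction_cvg (f := w) (f0 := u)).
  - by move=> n; exact: (Hw n).1.
  - exact: Hu.1.
  - by move=> n; exact/mcut/finite_energy_measurable.
  - exact/mcut/finite_energy_measurable.
  - by move=> n x; exact: unit_cut_le.
  - by move=> x; exact: unit_cut_le.
  - by [].
  - by apply: le_cvg0 => n; rewrite ip_ge0 ip_le_energy.
have cv2 : (fun n => ip M (grad (unit_cut \o w n) \- grad (unit_cut \o u))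
    (grad (unit_cut \o w n) \- grad (unit_cut \o u))) @ \oo --> 0.
  apply: (L2_contraction_cvg (f := fun n => grad (w n)) (f0 := grad u)).
  - by move=> n; exact: (Hw n).2.
  - exact: Hu.2.
  - by move=> n; apply: measurable_grad; apply: mcut; exact: finite_energy_measurable.
  - by apply: measurable_grad; apply: mcut; exact: finite_energy_measurable.
  - by move=> n x; exact: cutE.
  - exact: cutE.
  - apply: filterS2 (ae_fst cutw_ae) (ae_snd cutw_ae) => z z1 z2.
    by rewrite /grad; apply: cvgMl; exact: cvgB.
  - by apply: le_cvg0 => n; rewrite -grad_sub ip_ge0 ip_grad_le_energy.
move=> e e0; have : (fun n => energy ((unit_cut \o w n) \- (unit_cut \o u))) @ \oo --> 0.
  rewrite -[X in _ --> X](addr0 0) /energy.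
  by under eq_fun do rewrite grad_sub; exact: cvgD.
move=> /cvgrPdist_lt /(_ _ e0)[N _ /(_ N (leqnn N))] /=.
rewrite sub0r normrN ger0_norm ?energy_ge0// => lt.
by exists (fun x => unit_cut (w N x)); split; [exact: core_cut|rewrite energy_subC].
Qed.

Lemma closure_complete (s : nat -> T -> R) : (forall n, F (s n)) ->
  (forall e : R, 0 < e -> exists N, forall p q, (N <= p)%N -> (N <= q)%N ->
     nrm (s p \- s q) < e) ->
  exists u, F u /\ (fun n => nrm (s n \- u)) @ \oo --> (0 : R).
Proof.
move=> Fs cauchy; have Hs n := (Fs n).1.
have Hsub p q := finite_energy_sub (Hs p) (Hs q).
have /choice[N NP] : forall j : nat, exists N, forall p q, (N <= p)%N -> (N <= q)%N ->
    energy (s p \- s q) <= 8^-1 ^+ j.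
  move=> j; have e0 : 0 < 8^-1 ^+ j :> R by rewrite exprn_gt0.
  (* The factor [4^-1] offsets the [4] of [energy_le_fnorm]. *)
  have [|N NP] := cauchy (Num.sqrt (4^-1 * 8^-1 ^+ j)).
    by rewrite sqrtr_gt0 mulr_gt0.
  exists N => p q Np Nq; apply: le_trans (energy_le_fnorm (Hsub p q)) _.
  have := NP p q Np Nq; rewrite -ltr_sqr ?nnegrE ?sqrtr_ge0//.
  by rewrite [ltRHS]sqr_sqrtr; lra.
(* A running maximum, as [N] need not be monotone: [phi j] lies above [N i] for every [i <= j]. *)
pose phi j := \max_(i < j.+1) N i.
have phiN i j : (i <= j)%N -> (N i <= phi j)%N.
  move=> ij; rewrite -ltnS in ij.
  exact: (leq_bigmax (F := fun i : 'I_j.+1 => N i) (Ordinal ij)).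
pose t j := s (phi j).
have Lt n : L2 m (t n) := (Hs _).1.
have tfast n : ip m (t n.+1 \- t n) (t n.+1 \- t n) <= 8^-1 ^+ n.
  by apply: le_trans (ip_le_energy _) _; apply: NP; exact: phiN.
have [u [mu tu]] := L2_fast_cauchy_ae Lt tfast.
(* Fatou with [p] fixed and [j] going to infinity carries the Cauchy estimate for [s p - t j] over
   to [s p - u]; the [2] adds the L2 part and the gradient part. *)
have lim i p : (N i <= p)%N -> finite_energy (s p \- u) /\
    energy (s p \- u) <= 2 * 8^-1 ^+ i.
  move=> Np.
  have near_i (q : nat -> R) : (forall j, q j <= energy (s p \- t j)) ->
      \forall j \near \oo, q j <= 8^-1 ^+ i.
    move=> qle; exists i => // j /= ij; apply: le_trans (qle j) _.
    by apply: NP => //; exact: phiN.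
  have [L1 le1] : L2 m (s p \- u) /\ ip m (s p \- u) (s p \- u) <= 8^-1 ^+ i.
    apply: (L2_fatou (f := fun j => s p \- t j)).
    - by move=> j; exact: (Hsub _ _).1.
    - by apply: measurable_funB => //; exact: finite_energy_measurable.
    - by apply: filterS tu => x tx; apply: cvgB => //; exact: cvg_cst.
    - by apply: near_i => j; exact: ip_le_energy.
  have [L2' le2] : L2 M (grad (s p \- u)) /\
      ip M (grad (s p \- u)) (grad (s p \- u)) <= 8^-1 ^+ i.
    apply: (L2_fatou (f := fun j => grad (s p \- t j))).
    - by move=> j; exact: (Hsub _ _).2.
    - apply: measurable_grad => //; apply: measurable_funB => //.
      exact: finite_energy_measurable.
    - apply: filterS2 (ae_fst tu) (ae_snd tu) => z z1 z2.
      by rewrite /grad /=; apply: cvgMl; apply: cvgB; apply: cvgB => //; exact: cvg_cst.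
    - by apply: near_i => j; exact: ip_grad_le_energy.
  by split => //; rewrite /energy; lra.
have Hu : finite_energy u.
  have := finite_energy_sub (Hs (N 0)) (lim 0 _ (leqnn _)).1.
  by congr finite_energy; apply/funext => x /=; rewrite opprB addrC subrK.
exists u; split; first split => //.
  move=> e e0.
  (* [energy_sub_le] doubles both errors, [2 * 8 ^- i] for [u - s (N i)] and [e / 4] for
     [s (N i) - w]; each then stays below [e / 2]. *)
  have [i ilt] : exists i : nat, 4 * 8^-1 ^+ i < e / 2.
    have e8 : 0 < e / 8 by lra.
    have /cvgrPdist_lt /(_ _ e8)[i _ /(_ i (leqnn i))] /= := expr8_cvg0.
    by rewrite sub0r normrN ger0_norm ?exprn_ge0// => lt; exists i; lra.
  have e4 : 0 < e / 4 by lra.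
  have [w [cw wlt]] := (Fs (N i)).2 _ e4; exists w; split => //.
  apply: le_lt_trans (energy_sub_le Hu (core_finite_energy cw) (Hs (N i))) _.
  have := (lim i _ (leqnn _)).2; rewrite energy_subC; lra.
have K0 : 0 <= 2 * C + 2 by move: C_ge0; lra.
have sq (i : nat) : exists n0, forall n, (n0 <= n)%N ->
    nrm (s n \- u) <= Num.sqrt ((2 * C + 2) * (2 * 8^-1 ^+ i)).
  exists (N i) => n Nn; have [Hn le] := lim i n Nn.
  by apply: le_trans (fnorm_le_energy Hn) _; rewrite ler_wsqrtr// ler_wpM2l.
apply/cvgrPdist_lt => e e0.
have : (fun i => Num.sqrt ((2 * C + 2) * (2 * 8^-1 ^+ i))) @ \oo --> (0 : R).
  have lim0 : (fun i => (2 * C + 2) * (2 * 8^-1 ^+ i)) @ \oo --> (0 : R).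
    rewrite -[X in _ --> X](mulr0 (2 * C + 2)); apply: cvgMr.
    by rewrite -[X in _ --> X](mulr0 2); apply: cvgMr; exact: expr8_cvg0.
  rewrite -[X in _ --> X](@sqrtr0 R).
  exact: continuous_cvg (@sqrt_continuous R 0) lim0.
move=> /cvgrPdist_lt /(_ _ e0)[i _ /(_ i (leqnn i))] /=.
rewrite sub0r normrN ger0_norm ?sqrtr_ge0// => lt.
have [n0 n0P] := sq i; exists n0 => // n /= nn0.
by rewrite sub0r normrN ger0_norm ?sqrtr_ge0//; exact: le_lt_trans (n0P _ nn0) lt.
Qed.

Lemma closure_semi_dirichlet :
  lb_semi_dirichlet m jump_form F (C + 1) (2 + 4 * Num.sqrt C).
Proof.
split.
- by split; [move: C_ge0; lra|have := sqrtr_ge0 C; lra].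
- split; first by move=> u [[]].
  by split; [exact: core_closure|exact: closure_comb].
- split=> [a u v w [Hu _] [Hv _] [Hw _]|a u v w [Hu _] [Hv _] [Hw _]|].
  + exact: jump_form_combl.
  + exact: jump_form_combr.
  + by move=> u u' v v' [? _] [? _] [? _] [? _]; exact: eq_ae_jump_form.
- split; first by move=> u [Hu _]; exact: jump_form_lower_bounded.
  by move=> u v [Hu _] [Hv _]; exact: jump_form_sector.
- split; first exact: closure_complete.
  move=> u Fu u'; have Fu' : F u' by exact: closure_cut.
  split => //; apply: jump_form_cut_ge0 => //; [exact: Fu.1|exact: Fu'.1].
Qed.

Lemma closure_core_dense u e : F u -> 0 < e ->
  exists w, core w /\ nrm (u \- w) < e.
Proof.
move=> [Hu Au] e0.
have K0 : 0 < 2 * C + 2 by move: C_ge0; lra.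
have [|w [cw wu]] := Au (e ^+ 2 / (2 * C + 2)); first by rewrite divr_gt0// exprn_gt0.
exists w; split => //.
apply: le_lt_trans (fnorm_le_energy (finite_energy_sub Hu (core_finite_energy cw))) _.
rewrite -(@ger0_norm _ e) ?ltW// -sqrtr_sqr ltr_sqrt ?exprn_gt0//.
by rewrite mulrC -ltr_pdivlMr.
Qed.

End closure.
End jump_form.

(** * Metric topology *)

Section metric_topology.
Context (R : realType) (d : measure_display) (T : measurableType d).
Variable dist : T -> T -> R.
Hypothesis distm : is_metric dist.
Implicit Types (f g u v w : T -> R) (K U : set T).

Let dist_ge0 x y : 0 <= dist x y. Proof. by case: distm. Qed.
Let distC x y : dist x y = dist y x. Proof. by case: distm. Qed.
Let dist_trans y x z : dist x z <= dist x y + dist y z.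
Proof. by case: distm. Qed.
Let dist_eq0 x y : dist x y = 0 <-> x = y. Proof. by case: distm. Qed.
Let dist_xx x : dist x x = 0. Proof. exact/dist_eq0. Qed.

Lemma mopen_ball x r : mopen dist (mball dist x r).
Proof.
move=> y xy; exists (r - dist x y); split; first by rewrite subr_gt0.
move=> z yz; apply: le_lt_trans (dist_trans y x z) _.
by rewrite /mball /= in yz; lra.
Qed.

Lemma mopen_lt f a : mcontinuous dist f -> mopen dist [set x | f x < a].
Proof.
move=> cf x /= fxa; have [|e [e0 eP]] := cf x (a - f x); first by rewrite subr_gt0.
exists e; split => // y /eP; rewrite distrC => h /=.
by have := ler_norm (f y - f x); lra.
Qed.

Lemma lipschitz_mcontinuous L f : (forall x y, `|f x - f y| <= L * dist x y) ->
  mcontinuous dist f.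
Proof.
move=> fL x e e0; have L0 : 0 < `|L| + 1 by rewrite ltr_wpDl.
exists (e / (`|L| + 1)); split; first by rewrite divr_gt0.
move=> y; rewrite ltr_pdivlMr// => lt; apply: le_lt_trans (fL x y) _.
have := ler_norm L; have := dist_ge0 x y; nra.
Qed.

Lemma mcontinuous_comb a f g : mcontinuous dist f -> mcontinuous dist g ->
  mcontinuous dist (fun x => a * f x + g x).
Proof.
move=> cf cg x e e0; have a0 : 0 < `|a| + 1 by rewrite ltr_wpDl.
have [|df [df0 fP]] := cf x (e / 2 / (`|a| + 1)); first by rewrite divr_gt0//; lra.
have [|dg [dg0 gP]] := cg x (e / 2); first by lra.
exists (Num.min df dg); split; first by rewrite lt_min df0.
move=> y; rewrite lt_min => /andP[/fP + /gP].
rewrite ltr_pdivlMr// => h1 h2.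
have -> : a * f x + g x - (a * f y + g y) = a * (f x - f y) + (g x - g y) by ring.
apply: le_lt_trans (ler_normD _ _) _; rewrite normrM.
have := normr_ge0 (f x - f y); nra.
Qed.

Lemma mcontinuous_maxr0 f : mcontinuous dist f ->
  mcontinuous dist (fun x => Num.max (f x) 0).
Proof.
move=> cf x e e0; have [e' [e'0 eP]] := cf x e e0; exists e'; split => // y /eP.
apply: le_lt_trans; rewrite ler_norml.
have := ler_norm (f x - f y); have := ler_norm (f y - f x); rewrite distrC.
by case: (leP (f x) 0) => ?; case: (leP (f y) 0) => ? *; apply/andP; split; lra.
Qed.

Lemma mcompactU K K' : mcompact dist K -> mcompact dist K' ->
  mcompact dist (K `|` K').
Proof.
move=> cK cK' G oG cov.
have [|n [U [UG UK]]] := cK G oG; first by move=> x Kx; apply: cov; left.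
have [|n' [U' [UG' UK']]] := cK' G oG; first by move=> x Kx; apply: cov; right.
exists (n + n')%N, (fun i => if (i < n)%N then U i else U' (i - n)%N); split.
  move=> i lti; case: ifPn => [/UG//|]; rewrite -leqNgt => ni.
  by apply: UG'; rewrite ltn_subLR.
move=> x [/UK[i [ltin Ux]]|/UK'[i [ltin Ux]]].
  by exists i; rewrite ltin (ltn_addr _ ltin).
by exists (n + i)%N; rewrite ltn_add2l ltin ltnNge leq_addr /= addKn.
Qed.

Lemma mcompact0 : mcompact dist set0.
Proof. by move=> G _ _; exists 0%N, (fun=> set0); split. Qed.

(* Dini's argument: finitely many members of an increasing open cover reduce to one. *)
Lemma mcompact_nondecreasing_cover K (V : nat -> set T) : mcompact dist K ->
  (forall n, mopen dist (V n)) -> (forall i j, (i <= j)%N -> V i `<=` V j) ->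
  (forall x, K x -> exists n, V n x) -> exists n, K `<=` V n.
Proof.
move=> cK oV Vnd cov; have [||n [U [UG UK]]] := cK (range V).
- by move=> _ [n _ <-].
- by move=> x /cov[n Vx]; exists (V n) => //; exists n.
have /choice[N NP] : forall i, exists k, (i < n)%N -> U i = V k.
  move=> i; case: (ltnP i n) => [/UG[k _ <-]|_]; first by exists k.
  by exists 0%N.
exists (\max_(i < n) N i)%N => x /UK[i [ltin]]; rewrite (NP _ ltin).
exact/Vnd/(leq_bigmax (F := fun i : 'I_n => N i) (Ordinal ltin)).
Qed.

(** For [x] outside [K] the complements of the closed balls of radius [1 / n.+1] about [x] are open,
    increase with [n] and cover [K]; hence one of them contains [K]. *)
Lemma mcompact_closed K : mcompact dist K -> mopen dist (~` K).
Proof.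
move=> cK x Kx.
have cd : mcontinuous dist (fun y => - dist x y).
  apply: (@lipschitz_mcontinuous 1) => y z; rewrite mul1r ler_norml.
  have := dist_trans y x z; have := dist_trans z x y; rewrite (distC z y).
  by move=> ? ?; apply/andP; split; lra.
have [n KV] : exists n, K `<=` [set y | - dist x y < - n.+1%:R^-1].
  apply: mcompact_nondecreasing_cover => // [n|i j ij y /=|y Ky].
  - exact: mopen_lt.
  - by move/lt_le_trans; apply; rewrite lerN2 lef_pV2 ?posrE// ler_nat.
  - have d0 : 0 < dist x y.
      rewrite lt_def dist_ge0 andbT; apply: contra_notN Kx => /eqP xy.
      by rewrite ((dist_eq0 x y).1 xy).
    have [k kP] := ltr_add_invr d0.
    by exists k => /=; rewrite ltrN2 -(add0r _^-1).
exists n.+1%:R^-1; split; first by rewrite invr_gt0.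
by move=> y xy /KV /=; rewrite ltrN2 => /(lt_trans xy); rewrite ltxx.
Qed.

Lemma Cc_lip_Cc f : Cc_lip dist f -> Cc dist f.
Proof. by move=> [[L fL] cs]; split => //; exact: lipschitz_mcontinuous fL. Qed.

Lemma Cc_bounded f : Cc dist f -> exists2 B, 0 < B & forall x, `|f x| <= B.
Proof.
move=> [cf [K [cK fK]]].
have [n KV] : exists n, K `<=` [set x | `|f x| < n.+1%:R].
  apply: mcompact_nondecreasing_cover => // [n|i j ij x /=|x _].
  - apply: mopen_lt => x e e0; have [e' [e'0 eP]] := cf x e e0.
    by exists e'; split => // y /eP; apply: le_lt_trans; exact: ler_dist_dist.
  - by move/lt_le_trans; apply; rewrite ler_nat.
  - exists (Num.truncn `|f x|) => /=; exact: truncnS_gt.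
exists n.+1%:R => // x; have [/KV/ltW//|/fK ->] := pselect (K x).
by rewrite normr0.
Qed.

Lemma Cc_lip0 : Cc_lip dist (fun=> 0).
Proof.
split; first by exists 0 => x y; rewrite subrr normr0 mul0r.
by exists set0; split; [exact: mcompact0|].
Qed.

Lemma compact_support_comb a f g : compact_support dist f ->
  compact_support dist g -> compact_support dist (fun x => a * f x + g x).
Proof.
move=> [K [cK fK]] [K' [cK' gK']]; exists (K `|` K'); split; first exact: mcompactU.
by move=> x /not_orP[/fK -> /gK' ->]; rewrite mulr0 addr0.
Qed.

Lemma Cc_lip_comb a f g : Cc_lip dist f -> Cc_lip dist g ->
  Cc_lip dist (fun x => a * f x + g x).
Proof.
move=> [[L fL] csf] [[L' gL'] csg]; split; last exact: compact_support_comb.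
exists (`|a| * L + L') => x y.
have -> : a * f x + g x - (a * f y + g y) = a * (f x - f y) + (g x - g y) by ring.
apply: le_trans (ler_normD _ _) _; rewrite normrM mulrDl -mulrA lerD//.
exact: ler_wpM2l.
Qed.

Lemma Cc_lip_cut f : Cc_lip dist f -> Cc_lip dist (fun x => unit_cut (f x)).
Proof.
move=> [[L fL] [K [cK fK]]]; split.
  by exists L => x y; apply: le_trans (unit_cut_dist _ _) (fL x y).
exists K; split => // x /fK ->; apply/eqP.
by have := unit_cut_le (0 : R); rewrite normr0 normr_le0.
Qed.

(** * Lipschitz regularization of nonnegative functions *)

Section lipschitz_envelope.
Variable f : T -> R.
Hypothesis f_ge0 : forall x, 0 <= f x.

(** The inf-convolution of [f] with [n * dist], that is, the largest [n]-Lipschitz minorant of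
    [f]. *)
Definition lip_envelope (n : nat) x : R := inf (range (fun y => f y + n%:R * dist x y)).

Let env_has_inf n x : has_inf (range (fun y => f y + n%:R * dist x y)).
Proof.
split; first by exists (f x + n%:R * dist x x), x.
by exists 0 => _ [y _ <-]; rewrite addr_ge0// mulr_ge0.
Qed.

Let env_le n x y : lip_envelope n x <= f y + n%:R * dist x y.
Proof. by apply: ge_inf; [exact: (env_has_inf n x).2|exists y]. Qed.

Let env_ge n x a : (forall y, a <= f y + n%:R * dist x y) -> a <= lip_envelope n x.
Proof.
move=> aP; apply: lb_le_inf; first exact: (env_has_inf n x).1.
by move=> _ [y _ <-].
Qed.

Lemma lip_envelope_ge0 n x : 0 <= lip_envelope n x.
Proof. by apply: env_ge => y; rewrite addr_ge0// mulr_ge0. Qed.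

Lemma lip_envelope_le n x : lip_envelope n x <= f x.
Proof. by have := env_le n x x; rewrite dist_xx mulr0 addr0. Qed.

Lemma lip_envelope_lipschitz n x y :
  `|lip_envelope n x - lip_envelope n y| <= n%:R * dist x y.
Proof.
have half x' y' : lip_envelope n x' - n%:R * dist x' y' <= lip_envelope n y'.
  apply: env_ge => z; have := env_le n x' z; have := dist_trans y' x' z.
  have := ler0n R n; nra.
have := half x y; have := half y x; rewrite (distC y x) ler_norml => ? ?.
by apply/andP; split; lra.
Qed.

Lemma lip_envelope_nondecreasing i j x : (i <= j)%N ->
  lip_envelope i x <= lip_envelope j x.
Proof.
move=> ij; apply: env_ge => y; apply: le_trans (env_le i x y) _.
by rewrite lerD2l ler_wpM2r// ler_nat.
Qed.

(** Off [K] both functions vanish; on [K] the open sets where [f - lip_envelope n < e] increase with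
    [n], so a Dini argument reduces the claim to pointwise convergence. *)
Lemma lip_envelope_approx : Cc dist f -> forall e, 0 < e ->
  exists n, forall x, `|f x - lip_envelope n x| < e.
Proof.
move=> [cf [K [cK fK]]] e e0.
have ce n : mcontinuous dist (fun x => f x - lip_envelope n x).
  have -> : (fun x => f x - lip_envelope n x) = (fun x => (-1) * lip_envelope n x + f x).
    by apply/funext => x; ring.
  by apply: mcontinuous_comb => //; apply: lipschitz_mcontinuous (lip_envelope_lipschitz n).
have [n KV] : exists n, K `<=` [set x | f x - lip_envelope n x < e].
  apply: mcompact_nondecreasing_cover => // [n|i j ij x /=|x _].
  - exact: mopen_lt.
  - by have := lip_envelope_nondecreasing x ij; lra.
  - have [|e' [e'0 eP]] := cf x (e / 2); first by lra.
    (* With this index the penalty [n * dist x y] alone exceeds [f x] as soon as [dist x y >= e'];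
       for closer [y], [f y] is within [e / 2] of [f x]. *)
    exists (Num.truncn (f x / e')).+1 => /=.
    suff : f x - e / 2 <= lip_envelope (Num.truncn (f x / e')).+1 x by lra.
    apply: env_ge => y; have [xy|xy] := ltP (dist x y) e'.
      have := eP y xy; have := ler_norm (f x - f y).
      by have := mulr_ge0 (ler0n R (Num.truncn (f x / e')).+1) (dist_ge0 x y); lra.
    have : f x / e' < (Num.truncn (f x / e')).+1%:R by exact: truncnS_gt.
    rewrite ltr_pdivrMr// => lt; have := f_ge0 y.
    have := ler_wpM2l (ler0n R (Num.truncn (f x / e')).+1) xy; lra.
exists n => x; rewrite ger0_norm ?subr_ge0 ?lip_envelope_le//.
have [/KV//|/fK f0] := pselect (K x).
by have := lip_envelope_ge0 n x; lra.
Qed.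

(** Squeezed between [0] and [f], the envelope vanishes wherever [f] does; no further cut-off is
    called for. *)
Lemma lip_envelope_Cc_lip n : compact_support dist f -> Cc_lip dist (lip_envelope n).
Proof.
move=> [K [cK fK]]; split; first by exists n%:R; exact: lip_envelope_lipschitz.
exists K; split => // x /fK f0.
by apply/eqP; rewrite eq_le lip_envelope_ge0 -f0 lip_envelope_le.
Qed.

End lipschitz_envelope.

(** The envelope is for nonnegative functions, so the positive and negative parts of [f] are
    approximated separately, each within [e / 2]. *)
Lemma Cc_lip_dense f e : Cc dist f -> 0 < e ->
  exists g, Cc_lip dist g /\ forall x, `|f x - g x| < e.
Proof.
move=> [cf [K [cK fK]]] e0.
have pos h : mcontinuous dist h -> (forall x, ~ K x -> h x = 0) ->
    exists g, Cc_lip dist g /\ forall x, `|Num.max (h x) 0 - g x| < e / 2.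
  move=> ch hK; pose h' x := Num.max (h x) 0.
  have h'0 x : 0 <= h' x by rewrite le_max lexx orbT.
  have cs : compact_support dist h'.
    by exists K; split => // x /hK h0; rewrite /h' h0 maxxx.
  have [||n nP] := @lip_envelope_approx h' h'0 _ (e / 2).
  - by split => //; exact: mcontinuous_maxr0.
  - by lra.
  by exists (lip_envelope h' n); split => //; exact: lip_envelope_Cc_lip.
have [g [Lg gP]] := pos f cf fK.
have [||g' [Lg' gP']] := pos (fun x => (-1) * f x + 0).
- apply: mcontinuous_comb => // x e1 e10; exists 1; split => // y _.
  by rewrite subrr normr0.
- by move=> x /fK ->; rewrite mulr0 addr0.
exists (fun x => (-1) * g' x + g x); split; first exact: Cc_lip_comb.
move=> x; have := gP x; have := gP' x; rewrite !ltr_norml addr0 !mulN1r.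
by case: (leP (f x) 0) => ?; case: (leP (- f x) 0) => ? /andP[? ?] /andP[? ?];
  apply/andP; split; lra.
Qed.

(** * Measurability of the metric and sigma-finiteness *)

Section borel.
Hypothesis borel : borel_sigma dist.
Hypothesis sep : mseparable dist.

Lemma mopen_measurable U : mopen dist U -> measurable U.
Proof. by move=> oU; rewrite [measurable]borel; exact: sub_sigma_algebra. Qed.

Lemma mcompact_measurable K : mcompact dist K -> measurable K.
Proof.
by move/mcompact_closed/mopen_measurable/measurableC; rewrite setCK.
Qed.

Lemma mcontinuous_measurable f : mcontinuous dist f -> measurable_fun setT f.
Proof.
move=> cf; apply: (measurability _ (RGenInftyO.measurableE R)).
move=> _ [_ [a ->] <-]; rewrite setTI; apply: mopen_measurable.
have -> : f @^-1` `]-oo, a[%classic = [set x | f x < a].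
  by apply/seteqP; split => x /=; rewrite in_itv.
exact: mopen_lt.
Qed.

Let measurable_distr y : measurable_fun setT (fun x => dist x y).
Proof.
apply: mcontinuous_measurable; apply: (@lipschitz_mcontinuous 1) => x x'.
have := dist_trans x' x y; have := dist_trans x x' y.
by rewrite (distC x' x) mul1r ler_norml => ? ?; apply/andP; split; lra.
Qed.

(** The empty space is set apart because it carries no sequence. *)
Lemma separable_sequence : [set: T] = set0 \/ exists s : nat -> T,
  forall x (e : R), 0 < e -> exists n, dist x (s n) < e.
Proof.
have [D [cD dD]] := sep.
have [D0|/set0P[y0 Dy0]] := eqVneq D set0.
  left; apply/seteqP; split => // x _.
  by have [y [+ _]] := dD x 1 ltr01; rewrite D0.
right; have /countable_injP[f finj] := cD.
have /choice[s sP] : forall n, exists y, forall z, D z -> f z = n -> y = z.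
  move=> n; have [[y [Dy fy]]|none] := pselect (exists y, D y /\ f y = n).
    by exists y => z Dz fz; apply: finj; rewrite ?inE// fy fz.
  by exists y0 => z Dz fz; case: none; exists z.
exists s => x e e0; have [y [Dy xy]] := dD x e e0.
by exists (f y); rewrite (sP _ y).
Qed.

(** The product sigma-algebra need not in general contain the open sets of the product metric.
    Separability does it: [dist x y < a] holds exactly when [dist x (s n) + dist y (s n) < a] for
    some [n], and each of these countably many conditions is measurable. *)
Lemma measurable_dist : measurable_fun setT (fun z : T * T => dist z.1 z.2).
Proof.
have [T0|[s sP]] := separable_sequence.
  move=> _ Y mY; rewrite (_ : _ `&` _ = set0)//.
  by apply/seteqP; split => // z _; have : [set: T] z.1 by []; rewrite T0.
apply: (measurability _ (RGenInftyO.measurableE R)).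
move=> _ [_ [a ->] <-]; rewrite setTI.
have -> : (fun z : T * T => dist z.1 z.2) @^-1` `]-oo, a[%classic =
    \bigcup_n [set z | dist z.1 (s n) + dist z.2 (s n) < a].
  apply/seteqP; split => [z /=|z [n _ /=]]; rewrite in_itv /=.
    move=> lt; have [|n nP] := sP z.1 ((a - dist z.1 z.2) / 2); first by lra.
    exists n => //=; have := dist_trans z.1 z.2 (s n).
    by rewrite (distC z.2 z.1); lra.
  by apply: le_lt_trans; rewrite (distC z.2); exact: dist_trans.
apply: bigcupT_measurable => n; rewrite -[X in measurable X]setTI.
have mf : measurable_fun setT (fun z : T * T => dist z.1 (s n) + dist z.2 (s n)).
  apply: measurable_funD; last exact: (measurableT_comp (measurable_distr (s n)) measurable_snd).
  exact: (measurableT_comp (measurable_distr (s n)) measurable_fst).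
have := mf measurableT _ (measurable_itv `]-oo, a[).
by congr (measurable (_ `&` _)); apply/seteqP; split => z /=; rewrite in_itv.
Qed.

Lemma measurable_offdiag : measurable [set z : T * T | z.1 <> z.2].
Proof.
have := measurable_dist measurableT (measurable_itv `]0, +oo[).
rewrite setTI; congr measurable; apply/seteqP; split => z /=; rewrite in_itv/= andbT.
  by move=> d0 z12; move: d0; rewrite z12 dist_xx ltxx.
move=> z12; rewrite lt_def dist_ge0 andbT; apply/eqP => d0; apply: z12.
exact/dist_eq0.
Qed.

(** The balls of radius [1 / j.+1] about the points of a dense sequence that have finite measure
    cover the space: each point lies in one contained in a compact neighbourhood. Product measures
    and Fubini rest on this. *)
Lemma locally_compact_sigma_finite (m : {measure set T -> \bar R}) :
  mlocally_compact dist -> (forall K, mcompact dist K -> (m K < +oo)%E) ->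
  sigma_finite setT m.
Proof.
move=> lc fin; have [T0|[s sP]] := separable_sequence.
  exists (fun=> set0) => [|_]; first by rewrite T0 bigcup0.
  by split => //; rewrite measure0.
pose B (k : nat * nat) := mball dist (s k.1) k.2.+1%:R^-1.
(* Codes of no pair and balls of infinite measure contribute [set0]. *)
pose F n := if unpickle n is Some k then if `[< (m (B k) < +oo)%E >] then B k else set0
  else set0.
exists F => [|n].
  apply/seteqP; split => // x _.
  have [r [r0 [K [cK rK]]]] := lc x.
  have r2 : 0 < r / 2 by rewrite divr_gt0.
  have [j jP] := ltr_add_invr r2.
  rewrite add0r in jP.
  have [|n nP] := sP x j.+1%:R^-1; first by rewrite invr_gt0.
  have BK : B (n, j) `<=` K.
    move=> y By; apply: rK; apply: le_lt_trans (dist_trans (s n) x y) _.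
    by move: By jP nP; rewrite /B /mball /=; move: (j.+1%:R^-1) => t; lra.
  exists (pickle (n, j)) => //; rewrite /F pickleK ifT; first by rewrite /B /mball/= distC.
  apply/asboolP; apply: le_lt_trans (fin K cK); apply: le_measure => //; rewrite inE.
    exact/mopen_measurable/mopen_ball.
  exact: mcompact_measurable.
rewrite /F; case: (unpickle n) => [k|]; last by split => //; rewrite measure0.
case: asboolP => [mB|_]; last by split => //; rewrite measure0.
by split => //; exact/mopen_measurable/mopen_ball.
Qed.

End borel.
End metric_topology.

(** * Jump kernels *)

Section jump_kernel.
Context (R : realType) (d : measure_display) (T : measurableType d).
Variables (dist : T -> T -> R) (m : {sigma_finite_measure set T -> \bar R}).
Variable k : T -> T -> R.
Hypothesis distm : is_metric dist.
Hypothesis sep : mseparable dist.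
Hypothesis borel : borel_sigma dist.
Hypothesis finK : forall K, mcompact dist K -> (m K < +oo)%E.
Hypothesis k_ge0 : forall x y, x <> y -> 0 <= k x y.
Hypothesis mk : measurable_fun [set p : T * T | p.1 <> p.2] (fun p => k p.1 p.2).
Let F x := (\int[m]_(y in [set y | y <> x])
  (Num.min 1 (dist x y ^+ 2) * ks k x y)%:E)%E.
Hypothesis F_loc : forall K, mcompact dist K -> (\int[m]_(x in K) F x < +oo)%E.
Variable C : R.
Hypothesis ka_le : forall x, (\int[m]_(y in [set y | y <> x /\ ks k x y <> 0%R])
  ((ka k x y ^+ 2) / ks k x y)%:E <= C%:E)%E.
Local Notation M := (m \x m)%E.
Implicit Types u v w : T -> R.

(** Nothing is assumed of [k] on the diagonal; the extension by zero lets every integral over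
    [y <> x] run over the whole space. *)
Definition kern : T * T -> R :=
  (fun p => k p.1 p.2) \_ [set p : T * T | p.1 <> p.2].
Definition kern_s z : R := (kern z + kern (swap z)) / 2.
Definition kern_a z : R := (kern z - kern (swap z)) / 2.

Lemma kernE x y : y <> x -> kern (x, y) = k x y.
Proof. by move=> yx; rewrite /kern patchT// inE /= => /esym. Qed.

Lemma kern_diag x : kern (x, x) = 0.
Proof. by rewrite /kern patchN//; apply/negP; rewrite inE /=; apply. Qed.

Lemma kern_ge0 z : 0 <= kern z.
Proof.
case: z => x y; have [->|yx] := pselect (y = x); first by rewrite kern_diag.
by rewrite kernE// k_ge0// => /esym.
Qed.

Lemma kern_sE x y : y <> x -> kern_s (x, y) = ks k x y.
Proof.
move=> yx; rewrite /kern_s /ks kernE// /swap /= kernE//.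
by move=> /esym.
Qed.

Lemma kern_aE x y : y <> x -> kern_a (x, y) = ka k x y.
Proof.
move=> yx; rewrite /kern_a /ka kernE// /swap /= kernE//.
by move=> /esym.
Qed.

Lemma kern_s_diag x : kern_s (x, x) = 0.
Proof. by rewrite /kern_s /swap /= kern_diag addr0 mul0r. Qed.

Lemma kern_a_diag x : kern_a (x, x) = 0.
Proof. by rewrite /kern_a subrr mul0r. Qed.

Lemma kern_s_swap z : kern_s (swap z) = kern_s z.
Proof. by case: z => x y; rewrite /kern_s /swap /= addrC. Qed.

Lemma kern_a_swap z : kern_a (swap z) = - kern_a z.
Proof. by case: z => x y; rewrite /kern_a /swap /=; ring. Qed.

Lemma kern_a_le z : `|kern_a z| <= kern_s z.
Proof.
rewrite /kern_a /kern_s ler_norml.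
by have := kern_ge0 z; have := kern_ge0 (swap z) => ? ?; apply/andP; split; lra.
Qed.

Lemma kern_s_ge0 z : 0 <= kern_s z.
Proof. exact: le_trans (kern_a_le z). Qed.

Lemma measurable_kern : measurable_fun setT kern.
Proof.
apply/(measurable_restrictT _ _).1 => //.
exact: (measurable_offdiag distm borel sep).
Qed.

Let mkern_swap : measurable_fun setT (kern \o swap).
Proof. exact: measurableT_comp measurable_kern (@measurable_swap _ _ T T). Qed.

Lemma measurable_kern_s : measurable_fun setT kern_s.
Proof.
apply: measurable_funM => //; apply: measurable_funD => //; exact: measurable_kern.
Qed.

Lemma measurable_kern_a : measurable_fun setT kern_a.
Proof.
apply: measurable_funM => //; apply: measurable_funB => //; exact: measurable_kern.
Qed.

Let integral_offdiag (A : set T) (f g : T -> R) :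
  (forall y, A y -> f y = g y) -> (forall y, ~ A y -> g y = 0) ->
  (\int[m]_(y in A) (f y)%:E = \int[m]_y (g y)%:E)%E.
Proof.
move=> fg g0; rewrite integral_mkcond; apply: eq_integral => y _; rewrite patchE.
by case: ifPn => [/set_mem/fg ->//|/negP]; rewrite inE => /g0 ->.
Qed.

(** On an empty space [C] may be negative, whereas the abstract part asks for a nonnegative
    constant. *)
Let C' := Num.max C 0.
Let C'_ge0 : 0 <= C'. Proof. by rewrite le_max lexx orbT. Qed.

(** Division by [0] gives [0], so the quotient vanishes where [kern_s] does and the integral may be
    taken over the whole space. *)
Lemma kern_drift_le x :
  (\int[m]_y ((kern_a (x, y) ^+ 2) / kern_s (x, y))%:E <= C'%:E)%E.
Proof.
rewrite -(@integral_offdiag [set y | y <> x /\ ks k x y <> 0%R]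
  (fun y => (ka k x y ^+ 2) / ks k x y)).
- by apply: le_trans (ka_le x) _; rewrite lee_fin le_max lexx.
- by move=> y [yx _]; rewrite kern_sE// kern_aE.
- move=> y /not_andP[/contrapT ->|/contrapT].
    by rewrite kern_a_diag expr0n mul0r.
  have [->|yx] := pselect (y = x); first by rewrite kern_a_diag expr0n mul0r.
  by rewrite kern_sE// => ->; rewrite invr0 mulr0.
Qed.

Lemma F_kernE x : F x = (\int[m]_y (Num.min 1 (dist x y ^+ 2) * kern_s (x, y))%:E)%E.
Proof.
apply: integral_offdiag => // y => [yx|/contrapT ->]; first by rewrite kern_sE.
by rewrite kern_s_diag mulr0.
Qed.

Local Notation gr := (grad kern_s).
Local Notation dr := (drift kern_s kern_a).

Lemma EformE u v : Eform m k u v = (\int[m]_x \int[m]_y (gr u (x, y) * gr v (x, y))%:E)%E.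
Proof.
apply: eq_integral => x _; apply: integral_offdiag => // y.
  by move=> yx; rewrite (grad_gradE kern_a_le) /= kern_sE.
by move=> /contrapT ->; rewrite (grad_gradE kern_a_le) /= subrr !mul0r.
Qed.

Lemma AformE u v : Aform m k u v = (\int[m]_x \int[m]_y (gr u (x, y) * dr v (x, y))%:E)%E.
Proof.
apply: eq_integral => x _; apply: integral_offdiag => // y.
  by move=> yx; rewrite (grad_driftE kern_a_le) /= kern_aE.
by move=> /contrapT ->; rewrite (grad_driftE kern_a_le) /= subrr !mul0r.
Qed.

Lemma Aform_absE u v :
  Aform_abs m k u v = (\int[m]_x \int[m]_y `|gr u (x, y) * dr v (x, y)|%:E)%E.
Proof.
apply: eq_integral => x _; apply: integral_offdiag => // y.
  by move=> yx; rewrite (grad_driftE kern_a_le) /= kern_aE.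
by move=> /contrapT ->; rewrite (grad_driftE kern_a_le) /= subrr !mul0r normr0.
Qed.

Let mgr u : measurable_fun setT u -> measurable_fun setT (gr u).
Proof. by move=> mu; apply: measurable_grad => //; exact: measurable_kern_s. Qed.

Lemma Eform_sqrE u : measurable_fun setT u ->
  Eform m k u u = (\int[M]_z (gr u z ^+ 2)%:E)%E.
Proof.
move=> mu; rewrite EformE fubini_tonelli1 /fubini_F.
- by apply: eq_integral => x _; apply: eq_integral => y _; rewrite expr2.
- by apply/measurable_EFinP; apply: measurable_funX; exact: mgr.
- by move=> z; rewrite lee_fin sqr_ge0.
Qed.

Local Notation fin_energy := (finite_energy m kern_s).

Lemma Fr_finite_energy u : Fr m k u <-> fin_energy u.
Proof.
split=> [[[mu Lu] Eu]|[[mu Lu] [mg Lg]]]; split => //.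
- by split; [exact: mgr|rewrite -Eform_sqrE].
- by rewrite Eform_sqrE.
Qed.

Lemma E1_energyE u : fin_energy u -> E1 m k u = (energy m kern_s u)%:E.
Proof.
by move=> [Lu Du]; rewrite /E1 Eform_sqrE ?ip_sqrE//; exact: L2_measurable Lu.
Qed.

Lemma Eform_ipE u v : fin_energy u -> fin_energy v ->
  Eform m k u v = (ip M (gr u) (gr v))%:E.
Proof.
move=> [_ Du] [_ Dv]; have iuv := L2_mul_integrable Du Dv.
rewrite EformE /ip fineK; last exact: (integrable_fin_num measurableT iuv).
exact: (integral12_prod_meas1 iuv).
Qed.

Let Ldr v : L2 m v -> L2 M (dr v).
Proof.
exact: (L2_drift measurable_kern_s measurable_kern_a kern_s_swap kern_a_swap
  kern_a_le C'_ge0 kern_drift_le).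
Qed.

Lemma Aform_ipE u v : fin_energy u -> fin_energy v ->
  Aform m k u v = (ip M (gr u) (dr v))%:E.
Proof.
move=> [_ Du] [/Ldr Lv _]; have iuv := L2_mul_integrable Du Lv.
rewrite AformE /ip fineK; last exact: (integrable_fin_num measurableT iuv).
exact: (integral12_prod_meas1 iuv).
Qed.

Lemma Aform_abs_lty u v : fin_energy u -> fin_energy v ->
  (Aform_abs m k u v < +oo)%E.
Proof.
move=> [_ Du] [/Ldr Lv _]; have iuv := L2_mul_integrable Du Lv.
rewrite Aform_absE; exact: (integrable12ltyP _ _ (measurable_int _ iuv)).1 iuv.
Qed.

Local Notation jform := (jump_form m kern_s kern_a).

Lemma jump_formE u v : fin_energy u -> fin_energy v ->
  jform u v = 2^-1 * fine (Eform m k u v) + fine (Aform m k u v).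
Proof. by move=> Hu Hv; rewrite Eform_ipE// Aform_ipE. Qed.

Let mdist2 : measurable_fun setT (fun z : T * T => Num.min 1 (dist z.1 z.2 ^+ 2)).
Proof.
apply: measurable_minr => //; apply: measurable_funX.
exact: (measurable_dist distm borel sep).
Qed.

Let mini_ge0 x y : 0 <= Num.min 1 (dist x y ^+ 2).
Proof. by rewrite le_min ler01 sqr_ge0. Qed.

(** The first hypothesis makes it integrable for compact [K]; it serves as majorant for the
    gradients of Lipschitz functions and for the truncated integrands. *)
Definition local_kern K (z : T * T) : R :=
  \1_K z.1 * (Num.min 1 (dist z.1 z.2 ^+ 2) * kern_s z).

Lemma local_kern_ge0 K z : 0 <= local_kern K z.
Proof.
by apply: mulr_ge0 => //; apply: mulr_ge0; [exact: mini_ge0|exact: kern_s_ge0].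
Qed.

Lemma local_kern_integrable K : mcompact dist K ->
  M.-integrable setT (EFin \o local_kern K).
Proof.
move=> cK; have mK := mcompact_measurable distm borel cK.
have mker : measurable_fun setT (fun z : T * T => Num.min 1 (dist z.1 z.2 ^+ 2) * kern_s z).
  by apply: measurable_funM => //; exact: measurable_kern_s.
have mloc : measurable_fun setT (local_kern K).
  by apply: measurable_funM => //; apply: measurableT_comp => //; exact: measurable_indic.
apply/integrableP; split; first exact/measurable_EFinP.
under eq_integral do rewrite /= ger0_norm ?local_kern_ge0//.
rewrite fubini_tonelli1; last 2 first.
- exact/measurable_EFinP.
- by move=> z; rewrite lee_fin local_kern_ge0.
apply: le_lt_trans (F_loc cK); rewrite le_eqVlt; apply/orP; left; apply/eqP.
rewrite [RHS]integral_mkcond; apply: eq_integral => x _; rewrite patchE /fubini_F.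
rewrite /local_kern /= indicE; case: ifPn => xK /=.
  by rewrite F_kernE; apply: eq_integral => y _; rewrite mul1r.
by under eq_integral do rewrite mul0r; rewrite integral0.
Qed.

Lemma Cc_lip_measurable u : Cc_lip dist u -> measurable_fun setT u.
Proof.
move=> Lu; have [cu _] := Cc_lip_Cc distm Lu.
exact: (mcontinuous_measurable borel).
Qed.

(** [(u x - u y)^2] vanishes unless [x] or [y] is in [K]; it is at most [4 B^2] where
    [dist x y >= 1] and at most [L^2 dist x y ^ 2] elsewhere. So [c = L^2 + 4 B^2] times
    [local_kern K] plus its swapped copy dominates the squared gradient. *)
Lemma Cc_lip_finite_energy u : Cc_lip dist u -> fin_energy u.
Proof.
move=> Lu; have mu := Cc_lip_measurable Lu.
have [B B0 uB] := Cc_bounded (Cc_lip_Cc distm Lu); have B_ge0 := ltW B0.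
have [[L uL] [K [cK uK]]] := Lu.
have mK := mcompact_measurable distm borel cK.
split.
  apply: sqr_integrable_L2 => //.
  apply: (@le_integrable _ _ _ _ _ measurableT _ (EFin \o (fun x => B ^+ 2 * \1_K x))).
  - exact/measurable_EFinP/measurable_funX.
  - move=> x _ /=; rewrite lee_fin ger0_norm ?sqr_ge0// ger0_norm ?mulr_ge0 ?sqr_ge0//.
    have [Kx|/uK ->] := pselect (K x); last by rewrite expr0n mulr_ge0// sqr_ge0.
    by rewrite indicE mem_set// mulr1 -[leLHS]real_normK ?num_real// ler_sqr ?nnegrE.
  - have iK : m.-integrable setT (fun x => (\1_K x)%:E).
      apply/integrableP; split; first exact/measurable_EFinP/measurable_indic.
      under eq_integral do rewrite gee0_abs// ?lee_fin//.
      by rewrite integral_indic// setIT finK.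
    exact: (integrableZl measurableT (B ^+ 2) iK).
apply: sqr_integrable_L2; first exact: mgr.
pose c := L ^+ 2 + 4 * B ^+ 2.
have c0 : 0 <= c by rewrite /c; have := sqr_ge0 L; have := sqr_ge0 B; lra.
have ik := local_kern_integrable cK; have iks := integrable_swap ik.
have i2 : M.-integrable setT (fun z => c%:E * ((local_kern K z)%:E + (local_kern K (swap z))%:E))%E.
  by apply: (integrableZl measurableT); exact: (integrableD measurableT ik iks).
apply: le_integrable i2 => //; first by apply/measurable_EFinP; apply: measurable_funX; exact: mgr.
move=> [x y] _ /=; rewrite lee_fin.
have loc0 := addr_ge0 (local_kern_ge0 K (x, y)) (local_kern_ge0 K (y, x)).
rewrite ger0_norm ?sqr_ge0// ger0_norm ?mulr_ge0//.
rewrite /grad exprMn sqr_sqrtr ?kern_s_ge0// /local_kern /=.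
have -> : kern_s (y, x) = kern_s (x, y) := kern_s_swap (x, y).
have := kern_s_ge0 (x, y); move: (kern_s (x, y)) => q q0.
have [_ _ dC _] := distm; rewrite (dC y x).
rewrite [leRHS](_ : _ = c * (\1_K x + \1_K y) * Num.min 1 (dist x y ^+ 2) * q); last by ring.
apply: ler_wpM2r => //.
have [d2|d2] := leP 1 (dist x y ^+ 2).
  have uxy : (u x - u y) ^+ 2 <= 4 * B ^+ 2.
    have := uB x; have := uB y; rewrite !ler_norml => /andP[? ?] /andP[? ?]; nra.
  have L2p := sqr_ge0 L; have B2p := sqr_ge0 B.
  have [Kx|/uK ux] := pselect (K x).
    by rewrite !indicE [x \in K]mem_set//; case: (y \in K) => /=; rewrite /c; lra.
  have [Ky|/uK uy] := pselect (K y).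
    by rewrite !indicE [y \in K]mem_set//; case: (x \in K) => /=; rewrite /c; lra.
  by rewrite ux uy subrr expr0n !mulr_ge0.
have uxy : (u x - u y) ^+ 2 <= c * dist x y ^+ 2.
  have := uL x y; rewrite -ler_sqr ?nnegrE// ?(le_trans _ (uL x y))//.
  rewrite real_normK ?num_real// exprMn => le; apply: le_trans le _.
  by rewrite ler_wpM2r ?sqr_ge0// /c lerDl mulr_ge0// sqr_ge0.
have cd0 : 0 <= c * dist x y ^+ 2 by rewrite mulr_ge0// sqr_ge0.
have [Kx|/uK ux] := pselect (K x).
  by rewrite !indicE [x \in K]mem_set//; case: (y \in K) => /=; lra.
have [Ky|/uK uy] := pselect (K y).
  by rewrite !indicE [y \in K]mem_set//; case: (x \in K) => /=; lra.
rewrite ux uy subrr expr0n; apply: mulr_ge0; last exact: sqr_ge0.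
by rewrite mulr_ge0.
Qed.

Lemma F0_closure : F0 dist m k = energy_closure m kern_s (Cc_lip dist).
Proof.
apply/funext => u; apply/propext; split => -[Hu Au].
  have Hu' := (Fr_finite_energy u).1 Hu.
  split => // e /Au[w [Lw]]; rewrite E1_energyE; last first.
    by apply: finite_energy_sub => //; exact: Cc_lip_finite_energy.
  by rewrite lte_fin => we; exists w.
split; first exact/Fr_finite_energy.
move=> e /Au[w [Lw we]]; exists w; split => //; rewrite E1_energyE ?lte_fin//.
by apply: finite_energy_sub => //; exact: Cc_lip_finite_energy.
Qed.

(** * The truncated operators and their symmetrized integrals *)

Section truncation.
Variables (n : nat) (u v : T -> R).
Hypothesis n0 : (0 < n)%N.
Hypothesis Lu : Cc_lip dist u.
Hypothesis Lv : Cc_lip dist v.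

Definition far : set (T * T) := [set z | n%:R^-1 < dist z.1 z.2].

Lemma measurable_far : measurable far.
Proof.
have := measurable_dist distm borel sep measurableT (measurable_itv `]n%:R^-1, +oo[).
by rewrite setTI; congr measurable; apply/seteqP; split => z /=; rewrite in_itv/= andbT.
Qed.

Let g z : R := \1_far z * ((u z.2 - u z.1) * kern z).
Let h z : R := \1_far z * ((u z.1 - u z.2) * v z.1 * kern z).

Let hE x y : h (x, y) = - v x * g (x, y).
Proof. by rewrite /h /g /=; ring. Qed.

Lemma LnE x : Ln dist m k n u x = (\int[m]_y (g (x, y))%:E)%E.
Proof.
apply: integral_offdiag => // y /=; rewrite /g indicE => far_xy.
  rewrite mem_set// mul1r kernE// => yx; move: far_xy.
  have [_ d0 _ _] := distm; rewrite yx (d0 x x).2//.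
  by apply/negP; rewrite -leNgt.
by rewrite memNset// mul0r.
Qed.

Let mg : measurable_fun setT g.
Proof.
apply: measurable_funM; first by apply: measurable_indic; exact: measurable_far.
apply: measurable_funM; last exact: measurable_kern.
have mu := Cc_lip_measurable Lu.
by apply: measurable_funB; apply: measurableT_comp.
Qed.

Let mh : measurable_fun setT h.
Proof.
have -> : h = (fun z => (- v z.1) * g z) by apply/funext => -[x y]; exact: hE.
apply: measurable_funM; last exact: mg.
have mv := Cc_lip_measurable Lv.
by apply: measurableT_comp => //; exact: (measurableT_comp mv measurable_fst).
Qed.

(** The integral of [g (x, _)] need not converge absolutely for every [x], so Tonelli is applied to
    the positive and negative parts of [g]. *)
Lemma measurable_Ln : measurable_fun setT (Ln dist m k n u).
Proof.
have -> : Ln dist m k n u =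
    (fun x => (\int[m]_y ((EFin \o g)^\+%E (x, y)) - \int[m]_y ((EFin \o g)^\-%E (x, y)))%E).
  apply/funext => x; rewrite LnE integralE.
  congr (_ - _)%E; apply: eq_integral => y _.
    exact: (congr1 (@^~ y) (funepos_comp (EFin \o g) (pair x))).
  exact: (congr1 (@^~ y) (funeneg_comp (EFin \o g) (pair x))).
apply: emeasurable_funB.
- apply: (measurable_fun_fubini_tonelli_F (EFin \o g)^\+%E) => //.
  exact/measurable_funepos/measurable_EFinP.
- apply: (measurable_fun_fubini_tonelli_F (EFin \o g)^\-%E) => //.
  exact/measurable_funeneg/measurable_EFinP.
Qed.

(** On [far], [1 <= n^2 * min (1, d^2)]. With [k <= 2 k_s], [|u x - u y| <= 2 B] and [|v x| <= B']
    on the support [K] of [v], this gives the majorant [4 B B' n^2] times [local_kern K]. *)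
Lemma truncated_integrable : M.-integrable setT (EFin \o h).
Proof.
have [B B0 uB] := Cc_bounded (Cc_lip_Cc distm Lu).
have [B' B'0 vB] := Cc_bounded (Cc_lip_Cc distm Lv).
have [_ [K [cK vK]]] := Lv.
have i2 := integrableZl measurableT (4 * B * B' * n%:R ^+ 2) (local_kern_integrable cK).
apply: le_integrable i2 => //; first exact/measurable_EFinP.
move=> [x y] _ /=; rewrite lee_fin.
have B_ge0 := ltW B0; have B'_ge0 := ltW B'0.
have c0 : 0 <= 4 * B * B' * n%:R ^+ 2 by rewrite !mulr_ge0// sqr_ge0.
have cl0 := mulr_ge0 c0 (local_kern_ge0 K (x, y)).
rewrite (ger0_norm cl0) /h /local_kern /= !normrM.
rewrite (ger0_norm (kern_ge0 _)) indicE.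
case: (boolP (_ \in far)) => [/set_mem /= far_xy|_]; last first.
  by rewrite normr0 mul0r; exact: cl0.
rewrite normr1 mul1r; have [Kx|/vK ->] := pselect (K x); last first.
  by rewrite normr0 mulr0 mul0r; exact: cl0.
rewrite indicE mem_set// mul1r.
have k2 : kern (x, y) <= 2 * kern_s (x, y).
  by rewrite /kern_s; have := kern_ge0 (swap (x, y)); lra.
have n_gt0 : 0 < n%:R :> R by rewrite ltr0n.
have d1 : 1 <= n%:R ^+ 2 * Num.min 1 (dist x y ^+ 2).
  have n1 : 1 <= n%:R :> R by rewrite ler1n.
  have nd : 1 < n%:R * dist x y by rewrite -ltr_pdivrMl// mulr1.
  by case: (leP 1 (dist x y ^+ 2)) => _; nra.
have uu : `|u x - u y| <= 2 * B.
  by apply: le_trans (ler_normB _ _) _; have := uB x; have := uB y; lra.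
have e1 : `|u x - u y| * `|v x| <= 2 * B * B' by apply: ler_pM.
apply: (@le_trans _ _ (2 * B * B' * (2 * kern_s (x, y)))).
  by apply: ler_pM => //; exact: kern_ge0.
have -> : 4 * B * B' * n%:R ^+ 2 * (Num.min 1 (dist x y ^+ 2) * kern_s (x, y)) =
  2 * B * B' * (2 * kern_s (x, y)) * (n%:R ^+ 2 * Num.min 1 (dist x y ^+ 2)) by ring.
have BB0 : 0 <= 2 * B * B' by rewrite !mulr_ge0.
apply: ler_peMr => //; apply: mulr_ge0 => //; apply: mulr_ge0 => //.
exact: kern_s_ge0.
Qed.

(** This justifies the [fine] in [eta_n]: for almost every [x] with [v x <> 0], integrability of
    [h (x, _)] gives that of [g (x, _)], so [Ln] is finite there; where [v x = 0] both sides are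
    [0]. *)
Let LnM_ae : {ae m, forall x,
  (fine (Ln dist m k n u x) * v x)%:E = (- \int[m]_y (h (x, y))%:E)%E}.
Proof.
apply: filterS (ae_integrable1 truncated_integrable) => x ix.
have [v0|v0] := eqVneq (v x) 0.
  rewrite v0 mulr0; under eq_integral do rewrite hE v0 oppr0 mul0r.
  by rewrite integral0 oppe0.
have ig : m.-integrable setT (fun y => (g (x, y))%:E).
  have := integrableZl measurableT (- (v x)^-1) ix.
  apply: eq_integrable => // y _ /=; rewrite hE -EFinM; congr EFin.
  by field.
under eq_integral do rewrite hE EFinM.
rewrite integralZl// EFinM LnE fineK; last exact: (integrable_fin_num measurableT ig).
by rewrite EFinN mulNe oppeK muleC.
Qed.

Lemma Ln_mul_integrable :
  m.-integrable setT (fun x => (fine (Ln dist m k n u x) * v x)%:E).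
Proof.
have mL : measurable_fun setT (fun x => (fine (Ln dist m k n u x) * v x)%:E).
  apply/measurable_EFinP/measurable_funM; last exact: Cc_lip_measurable.
  exact: measurableT_comp measurable_Ln.
have iH := integrable_fubini_F truncated_integrable.
have mH := measurable_int _ iH.
apply/integrableP; split => //.
have [_] := integrableP _ _ _ iH.
congr (_ < _)%E; apply: ae_eq_integral => //; try exact: measurableT_comp.
by apply: filterS LnM_ae => x -> _; rewrite abseN.
Qed.

(** [eta_n] is the integral of [h], hence half that of [h + h \o swap]. As [far] is symmetric, this
    sum is the product of [grad u] and [sym_drift v] restricted to [far]. *)
Lemma eta_nE : eta_n dist m k n u v =
  2^-1 * fine (\int[M]_z (\1_far z * (gr u z * sym_drift kern_s kern_a v z))%:E)%E.
Proof.
have ih := truncated_integrable; have ihs := integrable_swap ih.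
have -> : eta_n dist m k n u v = fine (\int[M]_z (h z)%:E).
  rewrite /eta_n -(integral12_prod_meas1 ih) -fineN; congr fine.
  rewrite -[RHS]oppeK; congr (- _)%E.
  have iH := integrable_fubini_F ih; have mH := measurable_int _ iH.
  rewrite -[RHS]mulN1e -integralZl//; apply: ae_eq_integral => //.
  - exact: measurable_int Ln_mul_integrable.
  - exact: measurable_funeM.
  - by apply: filterS LnM_ae => x -> _; rewrite mulN1e.
have fin : (\int[M]_z (h z)%:E)%E \is a fin_num.
  exact: (integrable_fin_num measurableT ih).
have sw : (\int[M]_z (h (swap z))%:E = \int[M]_z (h z)%:E)%E := esym (integral_swap ih).
have -> : (\int[M]_z (\1_far z * (gr u z * sym_drift kern_s kern_a v z))%:E =
    \int[M]_z (h z)%:E + \int[M]_z (h (swap z))%:E)%E.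
  rewrite -(integralD measurableT ih ihs); apply: eq_integral => -[x y] _.
  rewrite (grad_sym_driftE kern_a_le) -EFinD /h /=; congr EFin.
  have -> : \1_far (y, x) = \1_far (x, y) :> R.
    have [_ _ dC _] := distm.
    by rewrite !indicE; congr (_ %:R); congr nat_of_bool; apply/idP/idP;
      rewrite !inE /far /= dC.
  by rewrite /kern_s /kern_a /swap /=; field.
by rewrite sw; move: fin; move: (\int[M]_z _)%E => I finI; rewrite fineD//; lra.
Qed.

End truncation.

Lemma eta_n_cvg u v : Cc_lip dist u -> Cc_lip dist v ->
  (fun n => eta_n dist m k n u v) @ \oo --> jform u v.
Proof.
move=> Lu Lv; have Hu := Cc_lip_finite_energy Lu; have Hv := Cc_lip_finite_energy Lv.
rewrite (jump_form_symmetrized measurable_kern_s measurable_kern_a kern_s_swap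
  kern_a_swap kern_a_le C'_ge0 kern_drift_le Hu Hv).
set W := sym_drift kern_s kern_a v.
have LW : L2 M W by exact: (L2_sym_drift measurable_kern_s measurable_kern_a kern_s_swap
  kern_a_swap kern_a_le C'_ge0 kern_drift_le Hv).
have iH := L2_mul_integrable Hu.2 LW; have mH := measurable_int _ iH.
pose H n z := (\1_(far n) z * (gr u z * W z))%:E.
have [|||||_ _ Hcvg] := @dominated_convergence _ _ _ M setT measurableT H
    (EFin \o (fun z => gr u z * W z)) (EFin \o (fun z => `|gr u z * W z|)).
- move=> n; apply/measurable_EFinP/measurable_funM; last exact/measurable_EFinP.
  by apply: measurable_indic; exact: measurable_far.
- by [].
- apply: nearW => -[x y] _ /=; apply: cvg_EFin; first exact: nearW.
  (* The indicator never reaches the diagonal, but [grad u] vanishes there. *)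
  have [xy|xy] := pselect (x = y).
    rewrite xy; under eq_fun do rewrite /H /grad /= subrr !mul0r mulr0.
    by rewrite /grad /= subrr !mul0r; exact: cvg_cst.
  have d0 : 0 < dist x y.
    have [dge0 deq0 _ _] := distm; rewrite lt_def dge0 andbT; apply/eqP.
    by move=> /deq0.
  have [N NP] := ltr_add_invr d0; rewrite add0r in NP.
  apply: cvg_near_cst; exists N.+1 => // n /= Nn.
  rewrite /H /= indicE mem_set ?mul1r// /far /=; apply: le_lt_trans NP.
  by rewrite lef_pV2 ?posrE ?ltr0n// ?ler_nat// (leq_trans _ Nn).
- exact: integrable_norm iH.
- apply: nearW => z n _ /=; rewrite lee_fin normrM indicE.
  by case: (_ \in _); rewrite ?normr1 ?normr0 ?mul1r ?mul0r.
have lim : (fun n => fine (\int[M]_z H n z)) @ \oo --> ip M (gr u) W.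
  apply: fine_cvg; rewrite /ip fineK; first exact: Hcvg.
  exact: (integrable_fin_num measurableT iH).
apply: (@cvg_trans _ ((fun n => 2^-1 * fine (\int[M]_z H n z)%E) @ \oo)).
  (* As [0^-1 = 0], the index [0] would truncate nothing. *)
  apply: near_eq_cvg; exists 1%N => // n /= n0.
  by rewrite (eta_nE n0 Lu Lv).
exact: cvgMr.
Qed.

Lemma Cc_lip_eta_limit u v : Cc_lip dist u -> Cc_lip dist v ->
  [/\ (forall n, (0 < n)%N ->
         m.-integrable setT (fun x => (fine (Ln dist m k n u x) * v x)%:E)),
      (Aform_abs m k u v < +oo)%E,
      (Eform m k u v \is a fin_num)%E &
      (fun n => eta_n dist m k n u v) @ \oo -->
        (2^-1 * fine (Eform m k u v) + fine (Aform m k u v))].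
Proof.
move=> Lu Lv; have Hu := Cc_lip_finite_energy Lu; have Hv := Cc_lip_finite_energy Lv.
split.
- by move=> n n0; exact: Ln_mul_integrable.
- exact: Aform_abs_lty.
- by rewrite Eform_ipE.
- by rewrite -jump_formE//; exact: eta_n_cvg.
Qed.

Lemma jump_form_regular_semi_dirichlet : exists alpha c : R,
  lb_semi_dirichlet m jform (F0 dist m k) alpha c /\
  regular_form dist m jform (F0 dist m k) alpha.
Proof.
exists (C' + 1), (2 + 4 * Num.sqrt C'); rewrite F0_closure; split.
  apply: (closure_semi_dirichlet measurable_kern_s measurable_kern_a kern_s_swap
    kern_a_swap kern_a_le C'_ge0 kern_drift_le) => //.
  - exact: Cc_lip_finite_energy.
  - exact: Cc_lip0.
  - exact: Cc_lip_comb.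
  - exact: Cc_lip_cut.
have core_closureP w : Cc_lip dist w -> energy_closure m kern_s (Cc_lip dist) w.
  by move=> Lw; apply: core_closure => //; exact: Cc_lip_finite_energy.
split=> [u Fu e e0|f Cf e e0].
  have [g [Lg ge]] := closure_core_dense measurable_kern_s measurable_kern_a kern_s_swap
    kern_a_swap kern_a_le C'_ge0 kern_drift_le Cc_lip_finite_energy Fu e0.
  by exists g; split; [exact: core_closureP|split => //; exact: Cc_lip_Cc].
have [g [Lg ge]] := Cc_lip_dense distm Cf e0.
by exists g; split; [exact: core_closureP|split => //; exact: Cc_lip_Cc].
Qed.

End jump_kernel.

Unset Implicit Arguments.
Set Strict Implicit.
Set Printing Implicit Defensive.

Theorem theorem1p1 (R : realType) (d : measure_display) (T : measurableType d)
  (dist : T -> T -> R) (m : {measure set T -> \bar R}) (k : T -> T -> R) :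
  is_metric dist ->
  mlocally_compact dist ->
  mseparable dist ->
  borel_sigma dist ->
  radon dist m ->
  full_support dist m ->
  (forall x y, x <> y -> 0 <= k x y) ->
  measurable_fun [set p : T * T | p.1 <> p.2] (fun p => k p.1 p.2) ->
  (* x |-> \int_{y <> x} (1 /\ d(x,y)^2) k_s(x,y) m(dy) is in L^1_loc(E,m) *)
  (let F : T -> \bar R := fun x => (\int[m]_(y in [set y | y <> x])
                        ((Num.min 1 (dist x y ^+ 2)) * ks k x y)%:E)%E in
   measurable_fun setT F /\
   forall K, mcompact dist K -> (\int[m]_(x in K) F x < +oo)%E) ->
  (exists C : R, forall x,
     (\int[m]_(y in [set y | y <> x /\ ks k x y <> 0%R])
        ((ka k x y ^+ 2) / ks k x y)%:E <= C%:E)%E) ->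
  (* (i) *)
  (forall u v, Cc_lip dist u -> Cc_lip dist v ->
     [/\ (forall n, (0 < n)%N ->
            m.-integrable setT (fun x => (fine (Ln dist m k n u x) * v x)%:E)),
         (Aform_abs m k u v < +oo)%E,
         (Eform m k u v \is a fin_num)%E &
         (fun n => eta_n dist m k n u v) @ \oo -->
            (2^-1 * fine (Eform m k u v) + fine (Aform m k u v))]) /\
  (* (ii) *)
  (exists eta : (T -> R) -> (T -> R) -> R,
     (forall u v, Cc_lip dist u -> Cc_lip dist v ->
        eta u v = limn (fun n => eta_n dist m k n u v)) /\
     exists alpha c : R,
       lb_semi_dirichlet m eta (F0 dist m k) alpha c /\
       regular_form dist m eta (F0 dist m k) alpha).
Proof.
move=> distm lc sep borel [finK _ _] _ k_ge0 mk [_ F_loc] [C ka_le].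
have sf := locally_compact_sigma_finite distm borel sep lc finK.
(* The product measure asks for a sigma-finite structure; it is attached to [m] itself, so
   statements about [m'] are statements about [m]. *)
pose sfinite := isSFinite.Build _ _ _ _ (sfinite_measure_sigma_finite sf).
pose sigma_finite := isSigmaFinite.Build _ _ _ _ sf.
pose m' := HB.pack_for {sigma_finite_measure set T -> \bar R} (Measure.sort m)
  sfinite sigma_finite.
split.
  exact: (@Cc_lip_eta_limit R d T dist m' k distm sep borel finK k_ge0 mk F_loc C ka_le).
exists (jump_form m' (kern_s k) (kern_a k)); split=> [u v Lu Lv|].
  apply/esym/cvg_lim => //.
  exact: (@eta_n_cvg R d T dist m' k distm sep borel finK k_ge0 mk F_loc C ka_le).
exact: (@jump_form_regular_semi_dirichlet R d T dist m' k distm sep borel finK k_ge0 mk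
  F_loc C ka_le).
Qed.
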